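(* Let $P_0$ be a lattice, let $P_1$ and $P_2$ be partial lattices, let $f_1\colon P_0\to P_1$ and $f_2\colon P_0\to P_2$ be homomorphisms of partial lattices, and let $S$ be a conditionally co-Brouwerian lattice. Let $\varphi_1\colon\mathrm{Con}_{\mathrm c}\,P_1\to S$ and $\varphi_2\colon\mathrm{Con}_{\mathrm c}\,P_2\to S$ be $\langle\vee,0\rangle$-homomorphisms such that $\varphi_1\circ\mathrm{Con}_{\mathrm c}\,f_1=\varphi_2\circ\mathrm{Con}_{\mathrm c}\,f_2$. Then there exist a relatively complemented lattice $L$, homomorphisms of partial lattices $g_1\colon P_1\to L$ and $g_2\colon P_2\to L$, and an isomorphism $\psi\colon\mathrm{Con}_{\mathrm c}\,L\to S$ such that $g_1\circ f_1=g_2\circ f_2$, $\varphi_i=\psi\circ\mathrm{Con}_{\mathrm c}\,g_i$ for $i=1,2$, the set $g_1[P_1]\cup g_2[P_2]$ generates $L$ as an ideal, and, if the $\langle\vee,0\rangle$-subsemilattice of $S$ generated by the union of the ranges of $\varphi_1$ and $\varphi_2$ is cofinal in $S$, then $g_1[P_1]\cup g_2[P_2]$ generates $L$ as a convex sublattice. Likewise, there exist such $L$, $g_1$, $g_2$, $\psi$ with the same properties except that ''generates $L$ as an ideal'' is replaced by ''generates $L$ as a filter''.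
   Context: A $\langle\vee,0\rangle$-semilattice is a join-semilattice with least element $0$; a $\langle\vee,0\rangle$-homomorphism is a map preserving $\vee$ and $0$. A $\langle\vee,0\rangle$-semilattice is co-Brouwerian if it is a complete lattice satisfying $a\vee\bigwedge_{i\in I}x_i=\bigwedge_{i\in I}(a\vee x_i)$ for all elements $a$ and families $(x_i)_{i\in I}$; it is conditionally co-Brouwerian if each of its principal ideals is co-Brouwerian. For a quasi-ordered set $P$, $X\subseteq P$ and $a\in P$, ''$a=\sup X$'' means that $a$ is an upper bound of $X$ and $a\le x$ for every upper bound $x$ of $X$; ''$a=\inf X$'' is defined dually. A partial prelattice is a structure $\langle P,\le,\bigvee,\bigwedge\rangle$ where $P$ is a nonempty set, $\le$ is a quasi-ordering on $P$, and $\bigvee,\bigwedge$ are partial functions from the set of nonempty finite subsets of $P$ to $P$ such that $a=\bigvee X$ implies $a=\sup X$ and $a=\bigwedge X$ implies $a=\inf X$. It is a partial lattice if $\le$ is antisymmetric. Lattices are identified with the partial lattices in which $\bigvee,\bigwedge$ are defined on all nonempty finite subsets. A congruence of $P$ is a quasi-ordering $\preceq$ of $P$ containing $\le$ such that $\langle P,\preceq,\bigvee,\bigwedge\rangle$ is a partial prelattice. The set $\mathrm{Con}\,P$ of all congruences of $P$, ordered by inclusion, is an algebraic lattice, and $\mathrm{Con}_{\mathrm c}\,P$ denotes the $\langle\vee,0\rangle$-semilattice of its compact elements. A homomorphism $f\colon P\to Q$ of partial lattices is an order-preserving map such that $a=\bigvee X$ implies $f(a)=\bigvee f[X]$ and $a=\bigwedge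 X$ implies $f(a)=\bigwedge f[X]$. The map $\mathrm{Con}_{\mathrm c}\,f\colon\mathrm{Con}_{\mathrm c}\,P\to\mathrm{Con}_{\mathrm c}\,Q$ sends $\boldsymbol a$ to the least congruence of $Q$ containing all pairs $\langle f(x),f(y)\rangle$ with $\langle x,y\rangle\in\boldsymbol a$. *)

(* Defs.v *)
From HB Require Import structures.
From mathcomp Require Import all_boot all_order.
From mathcomp Require Import boolp classical_sets functions cardinality.

Set Implicit Arguments.
Unset Strict Implicit.
Unset Printing Implicit Defensive.

Import Order.TTheory.
Local Open Scope classical_set_scope.
Local Open Scope order_scope.

Definition semilattice0_hom d d' (S : bJoinSemilatticeType d)
    (T : bJoinSemilatticeType d') (f : S -> T) : Prop :=
  {morph f : x y / x `|` y} /\ f \bot = \bot.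

Definition subsemilattice0 d (S : bJoinSemilatticeType d) (A : set S) : Prop :=
  A \bot /\ forall x y, A x -> A y -> A (x `|` y).

Definition cofinal d (S : porderType d) (A : set S) : Prop :=
  forall s, exists2 a, A a & s <= a.

(* A family (x_i) enters an infimum only through its range, hence the
   quantification over subsets; the empty set is included. *)
Definition co_Brouwerian d (S : bJoinSemilatticeType d) : Prop :=
  [/\ forall X : set S, supremums X !=set0,
      forall X : set S, infimums X !=set0
    & forall (a : S) (X : set S) (m : S), infimums X m ->
        infimums [set a `|` x | x in X] (a `|` m)].

Section PrincipalIdeal.
Variables (d : Order.disp_t) (S : bJoinSemilatticeType d) (e : S).

Definition principal_ideal := {x : S | x <= e}.

HB.instance Definition _ := SubChoice.copy principal_ideal {x : S | x <= e}.
HB.instance Definition _ :=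
  [SubChoice_isSubPOrder of principal_ideal by <: with d].

Fact pideal_join_subproof (x y : principal_ideal) : val x `|` val y <= e.
Proof. by rewrite leUx (valP x) (valP y). Qed.

Definition pideal_join (x y : principal_ideal) : principal_ideal :=
  exist _ (val x `|` val y) (pideal_join_subproof x y).

Fact pideal_leUx x y z :
  ((pideal_join x y : principal_ideal) <= z) = (x <= z) && (y <= z).
Proof. exact: leUx. Qed.

HB.instance Definition _ :=
  Order.POrder_isJoinSemilattice.Build _ principal_ideal pideal_leUx.

Definition pideal_bot : principal_ideal := exist _ \bot (le0x e).

Fact pideal_le0x (x : principal_ideal) : pideal_bot <= x.
Proof. exact: le0x. Qed.

HB.instance Definition _ := Order.hasBottom.Build _ principal_ideal pideal_le0x.

End PrincipalIdeal.

Definition conditionally_co_Brouwerian d (S : bJoinSemilatticeType d) : Prop :=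
  forall e : S, co_Brouwerian (principal_ideal e).

Definition relatively_complemented d (L : latticeType d) : Prop :=
  forall a b x : L, a <= x -> x <= b ->
    exists y : L, x `&` y = a /\ x `|` y = b.

Definition sublattice d (L : latticeType d) (A : set L) : Prop :=
  forall x y, A x -> A y -> A (x `&` y) /\ A (x `|` y).

Definition lattice_ideal d (L : latticeType d) (I : set L) : Prop :=
  [/\ I !=set0,
      forall x y, x <= y -> I y -> I x
    & forall x y, I x -> I y -> I (x `|` y)].

Definition lattice_filter d (L : latticeType d) (F : set L) : Prop :=
  [/\ F !=set0,
      forall x y, x <= y -> F x -> F y
    & forall x y, F x -> F y -> F (x `&` y)].

Definition convex_sublattice d (L : latticeType d) (A : set L) : Prop :=
  sublattice A /\ forall x y z, A x -> A z -> x <= y -> y <= z -> A y.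

Section QuasiOrder.
Variables (T : Type) (le : T -> T -> Prop).

Definition is_sup (X : set T) (a : T) : Prop :=
  (forall x, X x -> le x a) /\ forall b, (forall x, X x -> le x b) -> le a b.

Definition is_inf (X : set T) (a : T) : Prop :=
  (forall x, X x -> le a x) /\ forall b, (forall x, X x -> le b x) -> le b a.

(* The partial operations J and M take values in option T; [J X = Some a]
   reads "the join of X is defined and equal to a". *)
Record is_partial_prelattice (J M : set T -> option T) : Prop :=
  IsPartialPrelattice {
    ppl_inhabited : inhabited T;
    ppl_refl : forall x, le x x;
    ppl_trans : forall x y z, le x y -> le y z -> le x z;
    ppl_join_dom : forall X a, J X = Some a -> finite_set X /\ X !=set0;
    ppl_meet_dom : forall X a, M X = Some a -> finite_set X /\ X !=set0;
    ppl_join_sup : forall X a, J X = Some a -> is_sup X a;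
    ppl_meet_inf : forall X a, M X = Some a -> is_inf X a
  }.

End QuasiOrder.

Record partialLattice := PartialLattice {
  plat_sort :> Type;
  ple : plat_sort -> plat_sort -> Prop;
  pjoin : set plat_sort -> option plat_sort;
  pmeet : set plat_sort -> option plat_sort;
  plat_prelattice : is_partial_prelattice ple pjoin pmeet;
  ple_anti : forall x y, ple x y -> ple y x -> x = y
}.

Arguments ple {p} x y.
Arguments pjoin {p} X.
Arguments pmeet {p} X.

Record platHom (P Q : partialLattice) := PlatHom {
  plat_fun :> P -> Q;
  plat_hom_le : forall x y : P, ple x y -> ple (plat_fun x) (plat_fun y);
  plat_hom_join : forall (X : set P) (a : P),
    pjoin X = Some a -> pjoin (plat_fun @` X) = Some (plat_fun a);
  plat_hom_meet : forall (X : set P) (a : P),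
    pmeet X = Some a -> pmeet (plat_fun @` X) = Some (plat_fun a)
}.

Definition some_such (T : Type) (Q : T -> Prop) : option T :=
  if pselect (exists a, Q a) is left exQ then Some (projT1 (cid exQ)) else None.

Lemma some_such_sat T (Q : T -> Prop) a : some_such Q = Some a -> Q a.
Proof.
rewrite /some_such; case: pselect => // exQ [<-].
by case: (cid exQ).
Qed.

Lemma some_such_uniq T (Q : T -> Prop) a :
  (forall b, Q b -> b = a) -> Q a -> some_such Q = Some a.
Proof.
move=> Qu Qa; rewrite /some_such; case: pselect => [exQ|[]]; last by exists a.
by congr Some; case: (cid exQ) => b /= /Qu.
Qed.

Section LatticePartial.
Variables (d : Order.disp_t) (L : latticeType d).

Definition lattice_le (x y : L) : Prop := x <= y.

Definition lattice_pjoin (X : set L) : option L :=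
  some_such (fun a => [/\ finite_set X, X !=set0 & is_sup lattice_le X a]).

Definition lattice_pmeet (X : set L) : option L :=
  some_such (fun a => [/\ finite_set X, X !=set0 & is_inf lattice_le X a]).

Lemma lattice_pjoinE X a :
  lattice_pjoin X = Some a <->
  [/\ finite_set X, X !=set0 & is_sup lattice_le X a].
Proof.
split=> [H|H]; first exact: (some_such_sat H).
apply: some_such_uniq => // b [_ _ [ub lb]].
case: H => _ _ [ua la]; apply/eqP; rewrite eq_le.
by rewrite (lb _ ua : b <= a) (la _ ub : a <= b).
Qed.

Lemma lattice_pmeetE X a :
  lattice_pmeet X = Some a <->
  [/\ finite_set X, X !=set0 & is_inf lattice_le X a].
Proof.
split=> [H|H]; first exact: (some_such_sat H).
apply: some_such_uniq => // b [_ _ [ub lb]].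
case: H => _ _ [ua la]; apply/eqP; rewrite eq_le.
by rewrite (lb _ ua : a <= b) (la _ ub : b <= a).
Qed.

Lemma lattice_pjoin_total X : finite_set X -> X !=set0 ->
  exists a, lattice_pjoin X = Some a.
Proof.
move=> finX X0; suff [a supa] : exists a, is_sup lattice_le X a.
  by exists a; apply/lattice_pjoinE.
have [s Xs] := (finite_seqP X).1 finX; case: X0 => x0 Xx0.
exists (foldr Order.join x0 s); split=> [x|b ubb].
  rewrite Xs /= /lattice_le; elim: s {Xs} => //= y s IHs.
  by rewrite inE => /predU1P[->|/IHs xs]; rewrite lexU2 ?lexx ?xs ?orbT.
have: {in s, forall x, x <= b} by move=> x xs; apply: ubb; rewrite Xs.
rewrite /lattice_le; elim: s {Xs} => [_|y s IHs sb] /=; first exact: ubb.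
rewrite leUx sb ?mem_head//=; apply: IHs => x xs.
by apply: sb; rewrite inE xs orbT.
Qed.

Lemma lattice_pmeet_total X : finite_set X -> X !=set0 ->
  exists a, lattice_pmeet X = Some a.
Proof.
move=> finX X0; suff [a supa] : exists a, is_inf lattice_le X a.
  by exists a; apply/lattice_pmeetE.
have [s Xs] := (finite_seqP X).1 finX; case: X0 => x0 Xx0.
exists (foldr Order.meet x0 s); split=> [x|b ubb].
  rewrite Xs /= /lattice_le; elim: s {Xs} => //= y s IHs.
  by rewrite inE => /predU1P[->|/IHs xs]; rewrite leIx2 ?lexx ?xs ?orbT.
have: {in s, forall x, b <= x} by move=> x xs; apply: ubb; rewrite Xs.
rewrite /lattice_le; elim: s {Xs} => [_|y s IHs sb] /=; first exact: ubb.
rewrite lexI sb ?mem_head//=; apply: IHs => x xs.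
by apply: sb; rewrite inE xs orbT.
Qed.

Fact lattice_prelattice : inhabited L ->
  is_partial_prelattice lattice_le lattice_pjoin lattice_pmeet.
Proof.
move=> L0; split=> //.
- by move=> x; rewrite /lattice_le.
- by move=> x y z; apply: le_trans.
- by move=> X a /lattice_pjoinE[].
- by move=> X a /lattice_pmeetE[].
- by move=> X a /lattice_pjoinE[].
- by move=> X a /lattice_pmeetE[].
Qed.

Fact lattice_le_anti (x y : L) : lattice_le x y -> lattice_le y x -> x = y.
Proof. by move=> xy yx; apply/le_anti/andP. Qed.

(* A [latticeType] may be empty, a partial lattice may not. *)
Definition plat_of_lattice (L0 : inhabited L) : partialLattice :=
  PartialLattice (lattice_prelattice L0) lattice_le_anti.

End LatticePartial.

Section Con.
Variable P : partialLattice.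

Definition is_congruence (c : P -> P -> Prop) : Prop :=
  (forall x y, ple x y -> c x y) /\ is_partial_prelattice c pjoin pmeet.

Record con := Con { con_rel :> P -> P -> Prop; conP : is_congruence con_rel }.

HB.instance Definition _ := gen_eqMixin con.
HB.instance Definition _ := gen_choiceMixin con.

Lemma con_ext (c c' : con) : (forall x y, c x y <-> c' x y) -> c = c'.
Proof.
case: c c' => c cP [c' c'P] /= cc'.
have E : c = c' by apply/funext => x; apply/funext => y; apply/propext.
by case: c' / E c'P cc' => c'P _; congr Con; exact: Prop_irrelevance.
Qed.

Definition con_le (c c' : con) : bool := `[< forall x y, c x y -> c' x y >].

Fact con_le_refl : reflexive con_le.
Proof. by move=> c; apply/asboolP. Qed.

Fact con_le_anti : antisymmetric con_le.
Proof.
by move=> c c' /andP[/asboolP h /asboolP h']; apply: con_ext => x y; split; auto.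
Qed.

Fact con_le_trans : transitive con_le.
Proof.
by move=> c' c c'' /asboolP h /asboolP h'; apply/asboolP => x y /h /h'.
Qed.

Fact con_display : Order.disp_t. Proof. exact: Order.Disp tt tt. Qed.

HB.instance Definition _ :=
  Order.Le_isPOrder.Build con_display con con_le_refl con_le_anti con_le_trans.

Lemma con_leP (c c' : con) : reflect (forall x y, c x y -> c' x y) (c <= c').
Proof. exact: asboolP. Qed.

Fact con_gen_subproof (R : P -> P -> Prop) :
  is_congruence
    (fun x y => forall c : con, (forall u v, R u v -> c u v) -> c x y).
Proof.
split=> [x y xy c _|]; first exact: (conP c).1.
have pP := plat_prelattice P; split.
- exact: (ppl_inhabited pP).
- by move=> x c _; exact: (ppl_refl (conP c).2 x).
- move=> x y z xy yz c Rc.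
  exact: (ppl_trans (conP c).2 (xy c Rc) (yz c Rc)).
- exact: (ppl_join_dom pP).
- exact: (ppl_meet_dom pP).
- move=> X a Xa; split=> [x Xx c _|b ub c Rc].
    exact: (ppl_join_sup (conP c).2 Xa).1.
  by apply: (ppl_join_sup (conP c).2 Xa).2 => x Xx; apply: ub.
- move=> X a Xa; split=> [x Xx c _|b ub c Rc].
    exact: (ppl_meet_inf (conP c).2 Xa).1.
  by apply: (ppl_meet_inf (conP c).2 Xa).2 => x Xx; apply: ub.
Qed.

Definition con_gen (R : P -> P -> Prop) : con := Con (con_gen_subproof R).

Lemma con_gen_in (R : P -> P -> Prop) x y : R x y -> con_gen R x y.
Proof. by move=> Rxy c; apply. Qed.

Lemma con_gen_le (R : P -> P -> Prop) (c : con) :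
  (forall x y, R x y -> c x y) -> con_gen R <= c.
Proof. by move=> Rc; apply/con_leP => x y; apply. Qed.

Definition con_sup (X : set con) : con :=
  con_gen (fun x y => exists2 c, X c & c x y).

Lemma con_sup_ub (X : set con) c : X c -> c <= con_sup X.
Proof. by move=> Xc; apply/con_leP => x y cxy; apply: con_gen_in; exists c. Qed.

Lemma con_sup_lub (X : set con) c : (forall c', X c' -> c' <= c) -> con_sup X <= c.
Proof. by move=> ub; apply: con_gen_le => x y [c' /ub/con_leP]; apply. Qed.

Lemma con_supP (X : set con) : supremums X (con_sup X).
Proof.
split=> [c|c ub]; first exact: con_sup_ub.
exact: con_sup_lub.
Qed.

Lemma con_sup_eq (X : set con) s : supremums X s -> s = con_sup X.
Proof. by move=> Xs; apply: (is_subset1_supremums Xs (con_supP X)). Qed.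

Lemma con_supS (X Y : set con) : X `<=` Y -> con_sup X <= con_sup Y.
Proof. by move=> XY; apply: con_sup_lub => c /XY; apply: con_sup_ub. Qed.

End Con.

Definition compact_element d (T : porderType d) (c : T) : Prop :=
  forall (X : set T) (s : T), supremums X s -> c <= s ->
    exists F : set T, [/\ finite_set F, F `<=` X &
      exists2 t, supremums F t & c <= t].

Lemma finite_collect (T U : Type) (A : set T) (X : set U)
    (Q : T -> set U -> Prop) :
  finite_set A -> (forall p Y Z, Y `<=` Z -> Q p Y -> Q p Z) ->
  (forall p, A p -> exists F, [/\ finite_set F, F `<=` X & Q p F]) ->
  exists F, [/\ finite_set F, F `<=` X & forall p, A p -> Q p F].
Proof.
move=> finA Qmono QA.
have [h hP] : {h : T -> set U &
    forall p, A p -> [/\ finite_set (h p), h p `<=` X & Q p (h p)]}.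
  apply: (choice (P := fun p F => A p -> [/\ finite_set F, F `<=` X & Q p F])).
  move=> p; have [Ap|nAp] := pselect (A p); last by exists set0.
  by have [F FP] := QA p Ap; exists F.
exists (\bigcup_(p in A) h p); split.
- by apply: bigcup_finite => // p /hP[].
- by move=> u [p /hP[_ + _]]; apply.
- by move=> p Ap; have [_ _] := hP p Ap; apply: Qmono => u hu; exists p.
Qed.

Section ConCompact.
Variable P : partialLattice.

Lemma con_sup_fin (X : set (con P)) (x y : P) :
  con_sup X x y ->
  exists F, [/\ finite_set F, F `<=` X & con_sup F x y].
Proof.
pose D (x y : P) := exists F : set (con P),
  [/\ finite_set F, F `<=` X & con_sup F x y].
have supW (Y Z : set (con P)) u v : Y `<=` Z -> con_sup Y u v -> con_sup Z u v.
  by move=> YZ; apply/con_leP: u v; apply: con_supS.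
have pP := plat_prelattice P.
have lesup (Y : set (con P)) := conP (con_sup Y).
have DC : is_congruence D.
  split=> [u v uv|].
    by exists set0; split=> //; apply: (lesup _).1.
  split.
  - exact: (ppl_inhabited pP).
  - by move=> u; exists set0; split=> //; exact: (ppl_refl (lesup _).2 u).
  - move=> u v w [F [finF FX Fuv]] [G [finG GX Gvw]].
    exists (F `|` G); split; first by rewrite finite_setU.
      by move=> c [/FX|/GX].
    apply: (ppl_trans (lesup _).2).
      by apply: supW Fuv; apply: subsetUl.
    by apply: supW Gvw; apply: subsetUr.
  - exact: (ppl_join_dom pP).
  - exact: (ppl_meet_dom pP).
  - move=> A a Aa; split=> [u Au|b ub].
      by exists set0; split=> //; apply: (ppl_join_sup (lesup _).2 Aa).1.
    have [finA _] := ppl_join_dom pP Aa.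
    have [|F [finF FX Fb]] := finite_collect (X := X)
        (Q := fun u F => con_sup F u b) finA _ ub.
      by move=> u Y Z; apply: supW.
    by exists F; split=> //; apply: (ppl_join_sup (lesup _).2 Aa).2.
  - move=> A a Aa; split=> [u Au|b ub].
      by exists set0; split=> //; apply: (ppl_meet_inf (lesup _).2 Aa).1.
    have [finA _] := ppl_meet_dom pP Aa.
    have [|F [finF FX Fb]] := finite_collect (X := X)
        (Q := fun u F => con_sup F b u) finA _ ub.
      by move=> u Y Z; apply: supW.
    by exists F; split=> //; apply: (ppl_meet_inf (lesup _).2 Aa).2.
move=> /(_ (Con DC)) /=; apply => u v [c Xc cuv].
exists [set c]; split=> //; first by move=> _ ->.
by apply: con_gen_in; exists c.
Qed.

Definition con_fin (A : set (P * P)) : con P := con_gen (fun x y => A (x, y)).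

Lemma compact_con_fin (A : set (P * P)) :
  finite_set A -> compact_element (con_fin A).
Proof.
move=> finA X s /con_sup_eq -> /con_leP Xs.
have [||F [finF FX Fb]] := finite_collect (X := X)
    (Q := fun p F => con_sup F p.1 p.2) finA.
- by move=> p Y Z YZ; apply/con_leP: p.1 p.2; apply: con_supS.
- by move=> [x y] Axy; apply: con_sup_fin; apply: Xs; apply: con_gen_in.
exists F; split=> //; exists (con_sup F); first exact: con_supP.
by apply: con_gen_le => x y /Fb.
Qed.

Lemma compact_conP (c : con P) :
  compact_element c <-> exists2 A : set (P * P), finite_set A & c = con_fin A.
Proof.
split=> [cc|[A finA ->]]; last exact: compact_con_fin.
pose X : set (con P) := [set con_fin [set p] | p in [set p | c p.1 p.2]].
have [|F [finF FX [t /con_sup_eq -> ct]]] := cc X (con_sup X) (con_supP X).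
  apply/con_leP => x y cxy; apply: con_gen_in; exists (con_fin [set (x, y)]).
    by exists (x, y).
  exact: con_gen_in.
have [x0] := ppl_inhabited (plat_prelattice P).
have [h hP] : {h : con P -> P * P &
    forall c', F c' -> c (h c').1 (h c').2 /\ con_fin [set h c'] = c'}.
  apply: (choice (P := fun c' p => F c' -> c p.1 p.2 /\ con_fin [set p] = c')).
  move=> c'; have [Fc'|nF] := pselect (F c'); last by exists (x0, x0).
  by have [p cp pc'] := FX c' Fc'; exists p.
exists (h @` F); first exact: finite_image.
apply/eqP; rewrite eq_le; apply/andP; split.
  apply: le_trans ct _; apply: con_sup_lub => c' Fc'.
  have [_ hc'] := hP c' Fc'; rewrite -[X in X <= _]hc'.
  by apply: con_gen_le => x y /= xy; apply: con_gen_in; exists c'.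
by apply: con_gen_le => x y [c' Fc' hc']; have [] := hP c' Fc'; rewrite hc'.
Qed.

(* Con_c P: compact congruences of P, with the join computed in Con P; the
   bottom element is the ordering of P itself. *)
Record conc := Conc { conc_con :> con P; concP : compact_element conc_con }.

Arguments concP : clear implicits.

HB.instance Definition _ := gen_eqMixin conc.
HB.instance Definition _ := gen_choiceMixin conc.

Lemma conc_inj : injective conc_con.
Proof.
move=> [c cP] [c' c'P] /= E; case: c' / E c'P => c'P.
by congr Conc; exact: Prop_irrelevance.
Qed.

Definition conc_le (c c' : conc) : bool := (c : con P) <= c'.

Fact conc_le_refl : reflexive conc_le.
Proof. by move=> c; apply: lexx. Qed.

Fact conc_le_anti : antisymmetric conc_le.
Proof. by move=> c c' /le_anti/conc_inj. Qed.

Fact conc_le_trans : transitive conc_le.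
Proof. by move=> c' c c''; apply: le_trans. Qed.

HB.instance Definition _ :=
  Order.Le_isPOrder.Build con_display conc
    conc_le_refl conc_le_anti conc_le_trans.

Fact conc_join_subproof (c c' : conc) :
  compact_element (con_sup [set (c : con P); (c' : con P)]).
Proof.
move=> X s Xs cs.
have supin (e : con P) : [set (c : con P); (c' : con P)] e -> e <= s.
  by move=> /con_sup_ub /le_trans; apply.
have [F [finF FX [_ /con_sup_eq -> cF]]] := concP c _ _ Xs (supin c (or_introl erefl)).
have [G [finG GX [_ /con_sup_eq -> cG]]] := concP c' _ _ Xs (supin c' (or_intror erefl)).
exists (F `|` G); split; first by rewrite finite_setU.
  by move=> e [/FX|/GX].
exists (con_sup (F `|` G)); first exact: con_supP.
apply: con_sup_lub => e [] ->.
  by apply: le_trans cF _; apply: con_supS; apply: subsetUl.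
by apply: le_trans cG _; apply: con_supS; apply: subsetUr.
Qed.

Definition conc_join (c c' : conc) : conc := Conc (@conc_join_subproof c c').

Fact conc_leUx x y z : ((conc_join x y : conc) <= z) = (x <= z) && (y <= z).
Proof.
apply/idP/andP => [xyz|[xz yz]].
  by split; apply: le_trans xyz; apply: con_sup_ub; [left|right].
by apply: con_sup_lub => e [] ->.
Qed.

HB.instance Definition _ :=
  Order.POrder_isJoinSemilattice.Build _ conc conc_leUx.

Fact con_bot_subproof : is_congruence (@ple P).
Proof. by split=> //; apply: plat_prelattice. Qed.

Definition con_bot : con P := Con con_bot_subproof.

Fact con_bot_compact : compact_element con_bot.
Proof.
move=> X s _ _; exists set0; split=> //.
exists (con_sup set0); first exact: con_supP.
by apply/con_leP => x y; apply: (conP (con_sup set0)).1.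
Qed.

Definition conc_bot : conc := Conc con_bot_compact.

Fact conc_le0x (c : conc) : conc_bot <= c.
Proof. by apply/con_leP => x y; apply: (conP c).1. Qed.

HB.instance Definition _ := Order.hasBottom.Build _ conc conc_le0x.

End ConCompact.

Section ConcMap.
Variables (P Q : partialLattice) (f : platHom P Q).

Definition con_image (a : con P) : con Q :=
  con_gen (fun u v => exists x y : P, [/\ a x y, u = f x & v = f y]).

Lemma con_preim_subproof (c : con Q) : is_congruence (fun x y : P => c (f x) (f y)).
Proof.
have pP := plat_prelattice P; have cP := (conP c).2.
split=> [x y xy|]; first by apply: (conP c).1; apply: plat_hom_le.
split.
- exact: (ppl_inhabited pP).
- by move=> x; exact: (ppl_refl cP).
- by move=> x y z; exact: (ppl_trans cP).
- exact: (ppl_join_dom pP).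
- exact: (ppl_meet_dom pP).
- move=> X a /(plat_hom_join f) /(ppl_join_sup cP)[ub lub].
  split=> [x Xx|b bb]; first by apply: ub; exists x.
  by apply: lub => _ [x Xx <-]; apply: bb.
- move=> X a /(plat_hom_meet f) /(ppl_meet_inf cP)[ub lub].
  split=> [x Xx|b bb]; first by apply: ub; exists x.
  by apply: lub => _ [x Xx <-]; apply: bb.
Qed.

Fact con_image_compact (a : conc P) : compact_element (con_image a).
Proof.
have [A finA aA] := (compact_conP a).1 (@concP P a).
apply/compact_conP; exists [set (f p.1, f p.2) | p in A].
  exact: finite_image.
apply/eqP; rewrite eq_le; apply/andP; split; last first.
  apply: con_gen_le => u v [[x y] Axy [<- <-]]; apply: con_gen_in.
  by exists x, y; split=> //; rewrite aA; apply: con_gen_in.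
set c := (X in _ <= X); apply: con_gen_le => _ _ [x [y [axy -> ->]]].
move: axy; rewrite aA => /(_ (Con (con_preim_subproof c))) /=; apply => u v Auv.
by apply: con_gen_in; exists (u, v).
Qed.

(* Con_c f; compactness of the image uses that f is a homomorphism. *)
Definition conc_map (a : conc P) : conc Q := Conc (@con_image_compact a).

End ConcMap.

(* Main.v *)
Require Import Defs.
From HB Require Import structures.
From mathcomp Require Import all_boot all_order.
From mathcomp Require Import boolp classical_sets functions cardinality.
From Stdlib Require List.

Import Order.TTheory.
Local Open Scope classical_set_scope.
Local Open Scope order_scope.

(**
Read [d x y] in [S] as the truth value of "x <= y", with [0] for true and [\/]
for conjunction.  A lattice [L] carrying such a distance, with [d x y = 0] iff
[x <= y], is a lattice with a homomorphism from its compact congruences to [S],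
sending the congruence generated by [x <= y] to [d x y].  So [phi_i] makes [P_i]
an S-valued partial lattice, and since [S] is conditionally co-Brouwerian,
  d x y = inf over z in P0 of (d x (f1 z) \/ d (f2 z) y)
glues [P_1] and [P_2] along [P_0]; that declared finite joins and meets remain
correct uses that [P_0] is a lattice.

An S-valued partial lattice embeds in the S-valued lattice of its bounded
S-valued ideals.  Glueing to an S-valued lattice [T] one new point for each cut
(an ideal and a filter that could be the elements below and above a point),
declaring the joins and meets that are then correct, taking ideals and iterating
countably often produces an S-valued lattice in which every cut has a
realization with respect to any given finite set.  Suitable cuts provide
relative complements; for [a <= b <= c] with [d c a <= d b a], elements [p], [q]
with [b \/ p = b \/ q = c] and [p /\ q = a], so that collapsing [b] to [a]
collapses [c] to [a]; and elements at any prescribed distance below or above a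
given element, or inside an interval that is large enough.  Hence the ideal
(filter, convex sublattice) generated by [P_1] and [P_2], modulo [d = 0], is a
relatively complemented lattice whose compact congruences are exactly measured
by [d].
*)

Set Implicit Arguments.
Unset Strict Implicit.
Unset Printing Implicit Defensive.

(** * Infima in conditionally co-Brouwerian lattices *)

(** Settles inequalities between joins: each joinand on the left is searched for among those on the
    right, up to a hypothesis. *)
Ltac join_atom := first [exact: lexx | assumption | exact: le0x
  | apply: lexUl; join_atom | apply: lexUr; join_atom].
Ltac join_le := rewrite ?leUx; repeat (apply/andP; split); join_atom.

Section CoBrouwerian.
Variables (d : Order.disp_t) (S : bLatticeType d).
Hypothesis S_ccB : conditionally_co_Brouwerian S.

(** The principal ideal below [e], the join of [a], [x] and [y], contains every element involved;
    its distributive law is applied to the pair [x], [y]. *)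
Lemma ccB_joinI (a x y : S) : a `|` (x `&` y) = (a `|` x) `&` (a `|` y).
Proof.
apply/eqP; rewrite eq_le lexI !leU2//=; try exact: leIl; try exact: leIr.
pose e := a `|` x `|` y.
have [ae xe ye] : [/\ a <= e, x <= e & y <= e].
  by split; join_le.
pose pi z (ze : z <= e) : principal_ideal e := exist _ z ze.
have xye : x `&` y <= e by apply: le_trans xe; apply: leIl.
have axye : (a `|` x) `&` (a `|` y) <= e.
  by apply: le_trans (leIl _ _) _; rewrite leUx ae.
have [_ _ /(_ (pi a ae) [set pi x xe; pi y ye] (pi (x `&` y) xye))] := S_ccB e.
case=> [|_ /(_ (pi ((a `|` x) `&` (a `|` y)) axye))].
- split=> [z /= [] -> |z zlb].
  + exact: (leIl x y).
  + exact: (leIr y x).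
  + have zx : val z <= x := zlb (pi x xe) (or_introl erefl).
    have zy : val z <= y := zlb (pi y ye) (or_intror erefl).
    suff: val z <= x `&` y by [].
    by rewrite lexI zx.
- move=> h; apply: h => _ [z [] -> <-].
  + exact: (leIl (a `|` x) (a `|` y)).
  + exact: (leIr (a `|` y) (a `|` x)).
Qed.

Lemma ccB_meetU (a x y : S) : a `&` (x `|` y) = (a `&` x) `|` (a `&` y).
Proof.
rewrite ccB_joinI (join_r (leIl a x)) [(a `&` x) `|` y]joinC ccB_joinI meetA.
by rewrite (meet_l (leUr _ y)) joinC.
Qed.

(** Completeness is available only inside principal ideals. Truncating [X] below one of its members
    [x0] does not change the infimum, and the distributive law is imported from a larger ideal. *)
Lemma ccB_inf_exists (X : set S) : X !=set0 ->
  exists m, (forall x, X x -> m <= x) /\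
    forall a y, (forall x, X x -> y <= a `|` x) -> y <= a `|` m.
Proof.
move=> [x0 Xx0].
have ideal_inf e : x0 <= e -> exists m, [/\ m <= e, forall x, X x -> m <= x,
    forall y, (forall x, X x -> y <= x) -> y <= m &
    forall a y, a <= e -> y <= e -> (forall x, X x -> y <= a `|` x) ->
      y <= a `|` m].
  move=> x0e.
  have [_ /(_ [set u | exists2 x, X x & val u = x `&` e])[m mX] dist] := S_ccB e.
  have xe x : x `&` e <= e by exact: leIr.
  exists (val m); split.
  - exact: (valP m).
  - move=> x Xx; apply: le_trans (leIl _ e).
    by apply: (mX.1 (exist _ (x `&` e) (xe x))); exists x.
  - move=> y yX; have ye : y <= e by apply: le_trans x0e; apply: yX.
    apply: (mX.2 (exist _ y ye)) => u [x Xx ux].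
    suff: y <= val u by [].
    by rewrite ux lexI ye yX.
  - move=> a y ae ye yX.
    have [_ /(_ (exist _ y ye))] := dist (exist _ a ae) _ _ mX.
    apply=> _ [u [x Xx ux] <-].
    suff: y <= a `|` val u by [].
    by rewrite ux ccB_joinI lexI yX//= (le_trans ye) ?leUr.
have [m [_ mX mglb _]] := ideal_inf x0 (lexx _).
exists m; split=> // a y yX.
(* This ideal has room for [a] and [y]; its infimum [m'] is a lower bound of [X], hence below
   [m]. *)
have [|m' [_ m'X m'glb]] := ideal_inf (x0 `|` a `|` y); first by join_le.
move=> /(_ a y) h; apply: le_trans (h _ _ yX) _; try join_le.
by rewrite leU2 // mglb.
Qed.

(** The second clause combines being the greatest lower bound with the distributive law. The default
    [\bot] never occurs for nonempty [X]. *)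
Definition binf (X : set S) : S :=
  xget \bot [set m | (forall x, X x -> m <= x) /\
    forall a y, (forall x, X x -> y <= a `|` x) -> y <= a `|` m].

Lemma binf_lb (X : set S) x : X x -> binf X <= x.
Proof.
move=> Xx; rewrite /binf; case: xgetP => [m _ [mX _]|h]; first exact: mX.
by have [|m /h []] := @ccB_inf_exists X; first by exists x.
Qed.

Lemma binf_glb (X : set S) a y : X !=set0 ->
  (forall x, X x -> y <= a `|` x) -> y <= a `|` binf X.
Proof.
move=> X0 yX; rewrite /binf; case: xgetP => [m _ [_ mX]|h]; first exact: mX.
by have [m /h []] := ccB_inf_exists X0.
Qed.

Lemma binf_glb0 (X : set S) y : X !=set0 ->
  (forall x, X x -> y <= x) -> y <= binf X.
Proof.
by move=> X0 yX; rewrite -[binf X]join0x; apply: binf_glb => // x /yX; rewrite join0x.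
Qed.

End CoBrouwerian.

(** * Valued lattices and the ideal completion *)

Section ValuedStructures.
Variables (d : Order.disp_t) (S : bLatticeType d).

(* The value [vp_d x y] measures how far [x <= y] is from holding.  The relation
   [vp_join X a] declares [a] to be the join of [X], with value [\bot]. *)
Record vplat := VPlat {
  vp_sort :> Type;
  vp_d : vp_sort -> vp_sort -> S;
  vp_join : set vp_sort -> vp_sort -> Prop;
  vp_meet : set vp_sort -> vp_sort -> Prop;
  vp_pt : vp_sort;
  vp_refl : forall x, vp_d x x = \bot;
  vp_trans : forall y x z, vp_d x z <= vp_d x y `|` vp_d y z;
  vp_join_ub : forall X a x, vp_join X a -> X x -> vp_d x a = \bot;
  vp_join_lub : forall X a b s, vp_join X a ->
    (forall x, X x -> vp_d x b <= s) -> vp_d a b <= s;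
  vp_meet_lb : forall X a x, vp_meet X a -> X x -> vp_d a x = \bot;
  vp_meet_glb : forall X a b s, vp_meet X a ->
    (forall x, X x -> vp_d b x <= s) -> vp_d b a <= s
}.

(** The last two fields are the universal properties of join and meet with values in [S]; they fix
    joins and meets only up to distance [\bot] in both directions. *)
Record vlat := VLat {
  vl_sort :> Type;
  vl_d : vl_sort -> vl_sort -> S;
  vl_join : vl_sort -> vl_sort -> vl_sort;
  vl_meet : vl_sort -> vl_sort -> vl_sort;
  vl_pt : vl_sort;
  vl_refl : forall x, vl_d x x = \bot;
  vl_trans : forall y x z, vl_d x z <= vl_d x y `|` vl_d y z;
  vl_joinE : forall x y z, vl_d (vl_join x y) z = vl_d x z `|` vl_d y z;
  vl_meetE : forall x y z, vl_d z (vl_meet x y) = vl_d z x `|` vl_d z y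
}.

End ValuedStructures.

Arguments vp_d {d S v}.
Arguments vp_join {d S v}.
Arguments vp_meet {d S v}.
Arguments vp_pt {d S v}.
Arguments vl_d {d S v}.
Arguments vl_join {d S v}.
Arguments vl_meet {d S v}.
Arguments vl_pt {d S v}.

Lemma eq_from_le d (S : porderType d) (x y : S) :
  (forall s, (x <= s) = (y <= s)) -> x = y.
Proof. by move=> h; apply/eqP; rewrite eq_le h lexx -h lexx. Qed.

Section Ideals.
Variables (d : Order.disp_t) (S : bLatticeType d).
Hypothesis S_ccB : conditionally_co_Brouwerian S.
Variable W : vplat S.
Implicit Types (I J K : W -> S) (x y : W) (s : S).

(* [I x] is the value of "x belongs to I", so that inclusion of ideals is the
   reverse pointwise order. *)
Definition videal I : Prop :=
  (forall x y, I x <= vp_d x y `|` I y) /\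
  forall X a s, vp_join X a -> (forall x, X x -> I x <= s) -> I a <= s.

(** Bounds the distance, both ways, between [I] and the principal ideal of [vp_pt]. *)
Definition vbounded I : Prop := exists s, forall x,
  I x <= s `|` vp_d x vp_pt /\ vp_d x vp_pt <= s `|` I x.

Definition ideal_pred I := videal I /\ vbounded I.

Definition ideal := {I : W -> S | ideal_pred I}.

(* The boundedness condition makes this infimum one over a nonempty set. *)
Definition ideal_d (I J : ideal) : S :=
  binf [set r | forall x, sval J x <= r `|` sval I x].

Lemma ideal_dP (I J : ideal) s :
  (ideal_d I J <= s) <-> forall x, sval J x <= s `|` sval I x.
Proof.
split=> [IJ x|IJ]; last exact: (binf_lb S_ccB).
apply: (@le_trans _ _ (ideal_d I J `|` sval I x)); last by rewrite leU2.
rewrite joinC; apply: (binf_glb S_ccB) => [|r]; last by rewrite joinC; apply.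
have [_ [r hr]] := proj2_sig I; have [_ [r' hr']] := proj2_sig J.
exists (r `|` r') => y; apply: le_trans (hr' y).1 _; rewrite leUx.
rewrite lexUl ?leUr//=; apply: le_trans (hr y).2 _.
join_le.
Qed.

(** The co-Heyting difference of [a] and [b], left adjoint to joining with [b]. *)
Definition diff (a b : S) : S := binf [set r | a <= b `|` r].

Lemma diffP a b s : (diff a b <= s) <-> a <= b `|` s.
Proof.
split=> [ab|ab]; last exact: (binf_lb S_ccB).
apply: (@le_trans _ _ (b `|` diff a b)); last by rewrite leU2.
by apply: (binf_glb S_ccB) => //; exists a; rewrite /= leUr.
Qed.

(** Subtracting [s] turns an inclusion that holds up to [s] into an exact one, so that [join_fun_ub]
    can be applied up to [s]. *)
Lemma diff_ideal K s : videal K -> videal (fun x => diff (K x) s).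
Proof.
move=> [Kle Kj]; split=> [x y|X a r Xa h]; apply/diffP.
  apply: le_trans (Kle x y) _; rewrite leUx; apply/andP; split; first join_le.
  have /diffP h : diff (K y) s <= diff (K y) s by [].
  by apply: le_trans h _; join_le.
by apply: Kj Xa _ => x /h /diffP.
Qed.

Lemma meet_ideal I J : videal I -> videal J -> videal (fun x => I x `|` J x).
Proof.
move=> [Il Ij] [Jl Jj]; split=> [x y|X a s Xa h].
  have h1 := Il x y; have h2 := Jl x y; rewrite leUx.
  by rewrite (le_trans h1) ?(le_trans h2) //; join_le.
by rewrite leUx (Ij X) ?(Jj X) // => x /h; rewrite leUx => /andP[].
Qed.

Lemma meet_ideal_pred (I J : ideal) : ideal_pred (fun x => sval I x `|` sval J x).
Proof.
have [Ii [r hr]] := proj2_sig I; have [Ji [r' hr']] := proj2_sig J.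
split; first exact: meet_ideal.
exists (r `|` r') => x; have [h1 h2] := hr x; have [h3 h4] := hr' x; split.
  by rewrite leUx (le_trans h1) ?(le_trans h3) //; join_le.
by apply: le_trans h2 _; join_le.
Qed.

Definition ideal_meet (I J : ideal) : ideal :=
  exist _ _ (meet_ideal_pred I J).

(* The ideal generated by two ideals is the pointwise supremum of the ideals
   below both. *)
Definition join_fun I J x : S := binf [set r | forall K, videal K ->
   (forall y, K y <= I y) -> (forall y, K y <= J y) -> K x <= r].

Lemma join_fun_ub I J K x : videal K ->
  (forall y, K y <= I y) -> (forall y, K y <= J y) -> K x <= join_fun I J x.
Proof.
move=> Ki KI KJ; apply: (binf_glb0 S_ccB) => [|r]; last exact.
by exists (I x) => K' _ h _; apply: h.
Qed.

Lemma join_fun_lub I J x r : (forall K, videal K -> (forall y, K y <= I y) ->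
   (forall y, K y <= J y) -> K x <= r) -> join_fun I J x <= r.
Proof. exact: (binf_lb S_ccB). Qed.

Lemma join_fun_ideal I J : videal (join_fun I J).
Proof.
split=> [x y|X a s Xa h]; apply: join_fun_lub => K Ki KI KJ.
  by apply: le_trans (Ki.1 x y) _; rewrite leU2 // join_fun_ub.
have [_ Kj] := Ki; apply: (Kj X) => // x Xx; apply: le_trans (h x Xx).
exact: join_fun_ub.
Qed.

Lemma principal_ideal_fun a : videal (vp_d ^~ a).
Proof.
split=> [x y|X b s]; first exact: vp_trans.
exact: vp_join_lub.
Qed.

Lemma join_ideal_pred (I J : ideal) : ideal_pred (join_fun (sval I) (sval J)).
Proof.
have [Ii [r hr]] := proj2_sig I; have [Ji [r' hr']] := proj2_sig J.
split; first exact: join_fun_ideal.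
exists (r `|` r') => x; split.
  apply: join_fun_lub => K _ KI _; apply: le_trans (KI x) _.
  by apply: le_trans (hr x).1 _; join_le.
apply/diffP;
  (* The principal ideal of [vp_pt], lowered by both bounds, lies pointwise below [I] and [J], hence
     below their join. *)
  apply: (join_fun_ub (K := fun x => diff (vp_d x vp_pt) (r `|` r'))) => [|y|y].
- by apply/diff_ideal/principal_ideal_fun.
- by apply/diffP; apply: le_trans (hr y).2 _; join_le.
- by apply/diffP; apply: le_trans (hr' y).2 _; join_le.
Qed.

Definition ideal_join (I J : ideal) : ideal :=
  exist _ _ (join_ideal_pred I J).

Lemma principal_ideal_pred a : ideal_pred (vp_d ^~ a).
Proof.
split; first exact: principal_ideal_fun.
exists (vp_d a vp_pt `|` vp_d vp_pt a) => x; split.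
  by apply: le_trans (vp_trans vp_pt x a) _; join_le.
by apply: le_trans (vp_trans a x vp_pt) _; join_le.
Qed.

Definition pideal a : ideal := exist _ _ (principal_ideal_pred a).

Lemma ideal_refl (I : ideal) : ideal_d I I = \bot.
Proof. by apply/eqP; rewrite -lex0; apply/ideal_dP => x; rewrite join0x. Qed.

Lemma ideal_trans (J I K : ideal) : ideal_d I K <= ideal_d I J `|` ideal_d J K.
Proof.
apply/ideal_dP => x.
have /ideal_dP/(_ x) h1 := lexx (ideal_d I J).
have /ideal_dP/(_ x) h2 := lexx (ideal_d J K).
apply: le_trans h2 _; rewrite leUx; apply/andP; split; first join_le.
by apply: le_trans h1 _; join_le.
Qed.

Lemma ideal_joinE (I J K : ideal) :
  ideal_d (ideal_join I J) K = ideal_d I K `|` ideal_d J K.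
Proof.
apply: eq_from_le => s; apply/idP/idP; rewrite leUx.
  move=> /ideal_dP h; apply/andP; split; apply/ideal_dP => x;
    by apply: le_trans (h x) _; rewrite leU2 // join_fun_lub.
move=> /andP[/ideal_dP h /ideal_dP h']; apply/ideal_dP => x.
apply/diffP;
  apply: (join_fun_ub (K := fun x => diff (sval K x) s)) => [|y|y]; try exact/diffP.
by apply: diff_ideal; case: (proj2_sig K).
Qed.

Lemma ideal_meetE (I J K : ideal) :
  ideal_d K (ideal_meet I J) = ideal_d K I `|` ideal_d K J.
Proof.
apply: eq_from_le => s; apply/idP/idP; rewrite leUx.
  by move=> /ideal_dP h; apply/andP; split; apply/ideal_dP => x;
    apply: le_trans (h x); [rewrite leUl|rewrite leUr].
move=> /andP[/ideal_dP h /ideal_dP h']; apply/ideal_dP => x.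
by rewrite leUx h h'.
Qed.

Definition ideal_vlat : vlat S :=
  VLat (pideal vp_pt) ideal_refl ideal_trans ideal_joinE ideal_meetE.

Lemma pidealE a b : ideal_d (pideal a) (pideal b) = vp_d a b.
Proof.
apply/eqP; rewrite eq_le; apply/andP; split.
  by apply/ideal_dP => x /=; rewrite joinC vp_trans.
have /ideal_dP/(_ a) := lexx (ideal_d (pideal a) (pideal b)).
by rewrite /= vp_refl joinx0.
Qed.

(** Declared joins survive the completion because every ideal respects them by definition; declared
    meets survive because principal ideals compute distances to [a]. *)
Lemma pideal_join_lub X a (K : ideal) s : vp_join X a ->
  (forall x, X x -> ideal_d (pideal x) K <= s) -> ideal_d (pideal a) K <= s.
Proof.
move=> Xa h; apply/ideal_dP => y; have [[Kle Kj] _] := proj2_sig K.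
apply: le_trans (Kle y a) _; rewrite joinC leU2 //; apply: Kj Xa _ => x Xx.
by have /ideal_dP/(_ x) := h x Xx; rewrite /= vp_refl joinx0.
Qed.

Lemma pideal_meet_glb X a (K : ideal) s : vp_meet X a ->
  (forall x, X x -> ideal_d K (pideal x) <= s) -> ideal_d K (pideal a) <= s.
Proof.
move=> Xa h; apply/ideal_dP => y; apply: vp_meet_glb Xa _ => x Xx.
by have /ideal_dP/(_ y) := h x Xx.
Qed.

End Ideals.

(** * Amalgamation over a valued lattice *)

(** [List.In] asks for no decidable equality on [A]; [{classic A}] provides the one that
    [finite_seqP] needs. *)
Lemma finite_set_list (A : Type) (X : set A) : finite_set X ->
  exists xs : seq A, forall x, X x <-> List.In x xs.
Proof.
move=> finX; have [xs Xxs] := (@finite_seqP {classic A} X).1 finX.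
exists xs => x; rewrite Xxs /=.
elim: xs {Xxs} => //= y xs IH; rewrite inE; split=> [/predU1P[->|/IH]|[->|/IH h]]; auto.
  exact: mem_head.
by rewrite h orbT.
Qed.

Section DirectedInfimum.
Variables (d : Order.disp_t) (S : bLatticeType d) (A T : Type).
Variables (h : A -> T -> S) (g : T -> S) (i : A -> S) (op : T -> T -> T).
Hypothesis h_opl : forall x z z', h x (op z z') <= h x z.
Hypothesis h_opr : forall x z z', h x (op z z') <= h x z'.
Hypothesis g_op : forall z z', g (op z z') <= g z `|` g z'.
Hypothesis i_glb : forall x m s,
  (forall z, m <= s `|` (h x z `|` g z)) -> m <= s `|` i x.

(* The infima [i x] of [h x z \/ g z] over [z] are approximated by a common [z]
   for finitely many [x], since [op] moves [z] and [z'] together. *)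
Lemma finite_inf_directed (X : set A) (m s : S) :
  finite_set X -> X !=set0 -> (forall x, X x -> i x <= s) ->
  (forall z r, (forall x, X x -> h x z <= r) -> g z <= r -> m <= r `|` s) ->
  m <= s.
Proof.
move=> /finite_set_list[[|x0 xs] Xxs] [x Xx]; first by have := (Xxs x).1 Xx.
move=> hs; have {hs} : forall x, List.In x (x0 :: xs) -> i x <= s.
  by move=> y /Xxs; apply: hs.
move=> hs hm; have {hm Xxs x Xx} : forall z r,
    (forall x, List.In x (x0 :: xs) -> h x z <= r) -> g z <= r -> m <= r `|` s.
  by move=> z r hx; apply: hm => y /Xxs; apply: hx.
elim: xs x0 hs => [|x1 xs IH] x0 hs hm.
  rewrite -(join_l (hs x0 (or_introl erefl))); apply: i_glb => z.
  rewrite joinC; apply: (hm z) => [_ [<-|[]]|]; [exact: leUl|exact: leUr].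
apply: (IH x1) => [x xin|z' r' hr' gr']; first by apply: hs; right.
(* As [i x0] is already below the bound, it may be joined to it and then opened as an infimum over
   [z]; [op z z'] serves [x0] together with the rest of the list. *)
have /join_l <- : i x0 <= r' `|` s by rewrite lexU2 // hs ?orbT //=; left.
apply: i_glb => z.
apply: le_trans (hm (op z z') (r' `|` (h x0 z `|` g z)) _ _) _; last first.
- join_le.
- by apply: le_trans (g_op _ _) _; join_le.
- move=> x [<-|xin]; first by apply: le_trans (h_opl _ _ _) _; join_le.
  by apply: le_trans (h_opr _ _ _) _; have := hr' x xin; join_le.
Qed.

End DirectedInfimum.

Section Amalgam.
Variables (d : Order.disp_t) (S : bLatticeType d).
Hypothesis S_ccB : conditionally_co_Brouwerian S.
Variables (T : vlat S) (K : eqType) (k0 : K) (W : K -> vplat S).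
Variable f : forall k, T -> W k.
Hypothesis f_d : forall k x y, vp_d (f k x) (f k y) = vl_d x y.
Hypothesis f_join : forall k x y w,
  vp_d (f k (vl_join x y)) w <= vp_d (f k x) w `|` vp_d (f k y) w.
Hypothesis f_meet : forall k x y w,
  vp_d w (f k (vl_meet x y)) <= vp_d w (f k x) `|` vp_d w (f k y).
Hypothesis W_join_fin : forall k (X : set (W k)) a,
  vp_join X a -> finite_set X /\ X !=set0.
Hypothesis W_meet_fin : forall k (X : set (W k)) a,
  vp_meet X a -> finite_set X /\ X !=set0.

Definition amalgam_sort := {k : K & W k}.
Notation inj x := (@existT K (fun k => vp_sort (W k)) _ x : amalgam_sort).
Implicit Types p q r : amalgam_sort.

(** Inside one component the direct distance is the least term, by transitivity; between components
    only passages through a single point of [T] count. *)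
Definition amalgam_d p q : S := binf [set s |
  (tag p == tag q /\ s = vp_d (tagged p) (tagged_as p q)) \/
  exists z, s = vp_d (tagged p) (f (tag p) z) `|` vp_d (f (tag q) z) (tagged q)].

Lemma amalgam_d_le p q z :
  amalgam_d p q <= vp_d (tagged p) (f (tag p) z) `|` vp_d (f (tag q) z) (tagged q).
Proof. by apply: (binf_lb S_ccB); right; exists z. Qed.

Lemma amalgam_dE k (x y : W k) : amalgam_d (inj x) (inj y) = vp_d x y.
Proof.
have E : tagged_as (inj x) (inj y) = y.
  exact: (@tagged_asE K (fun k => vp_sort (W k)) (inj x) y).
apply/eqP; rewrite eq_le; apply/andP; split.
  by apply: (binf_lb S_ccB); left; rewrite E.
apply: (binf_glb0 S_ccB) => [|s [[_ ->]|[z ->]]]; last exact: vp_trans.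
  by exists (vp_d x y); left; rewrite E.
by rewrite E.
Qed.

Lemma amalgam_d_glb k l (x : W k) (y : W l) m s : k != l ->
  (forall z, m <= s `|` (vp_d x (f k z) `|` vp_d (f l z) y)) ->
  m <= s `|` amalgam_d (inj x) (inj y).
Proof.
move=> kl h; apply: (binf_glb S_ccB) => [|r [[/= E]|[z ->//]]].
  by eexists; right; exists (vl_pt).
by rewrite E in kl.
Qed.

Lemma amalgam_refl p : amalgam_d p p = \bot.
Proof. by case: p => k x; rewrite amalgam_dE vp_refl. Qed.

Lemma amalgam_trans q p r : amalgam_d p r <= amalgam_d p q `|` amalgam_d q r.
Proof.
case: p q r => [k x] [l y] [m w].
have [kl|kl] := eqVneq k l; have [lm|lm] := eqVneq l m.
- by subst l m; rewrite !amalgam_dE vp_trans.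
- subst l; apply: amalgam_d_glb => // z; rewrite amalgam_dE.
  apply: le_trans (amalgam_d_le _ _ z) _ => /=.
  have := vp_trans y x (f k z) => h.
  by rewrite leUx (le_trans h) /=; join_le.
- subst m; rewrite joinC; apply: amalgam_d_glb => // z; rewrite amalgam_dE.
  apply: le_trans (amalgam_d_le _ _ z) _ => /=.
  have := vp_trans y (f l z) w => h.
  by rewrite leUx [X in _ && X](le_trans h) /= ?andbT; join_le.
(* The path leaves [k] at [z'] but enters [m] at [z]. The missing distance from [z'] to [z] is the
   same in [W l] and [W m], and in [W l] it is bounded through [y]. *)
apply: amalgam_d_glb => // z; rewrite joinC; apply: amalgam_d_glb => // z'.
apply: le_trans (amalgam_d_le _ _ z') _ => /=.
have h1 := vp_trans (f m z) (f m z') w.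
have h2 := vp_trans y (f l z') (f l z).
rewrite leUx; apply/andP; split; first join_le.
apply: le_trans h1 _; rewrite f_d -(f_d l) leUx; apply/andP; split; last join_le.
by apply: le_trans h2 _; join_le.
Qed.

Definition amalgam_join (Y : set amalgam_sort) (b : amalgam_sort) : Prop :=
  exists k (X : set (W k)) (a : W k),
    [/\ vp_join X a, Y = [set inj x | x in X] & b = inj a].

Definition amalgam_meet (Y : set amalgam_sort) (b : amalgam_sort) : Prop :=
  exists k (X : set (W k)) (a : W k),
    [/\ vp_meet X a, Y = [set inj x | x in X] & b = inj a].

Lemma amalgam_join_ub Y b p : amalgam_join Y b -> Y p -> amalgam_d p b = \bot.
Proof.
move=> [k [X [a [Xa -> ->]]]] [x Xx <-].
by rewrite amalgam_dE (vp_join_ub Xa).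
Qed.

Lemma amalgam_meet_lb Y b p : amalgam_meet Y b -> Y p -> amalgam_d b p = \bot.
Proof.
move=> [k [X [a [Xa -> ->]]]] [x Xx <-].
by rewrite amalgam_dE (vp_meet_lb Xa).
Qed.

Lemma f_anti k w x y : vp_d w (f k (vl_join x y)) <= vp_d w (f k x) /\
  vp_d w (f k (vl_join x y)) <= vp_d w (f k y).
Proof.
have := vl_refl (vl_join x y); rewrite vl_joinE => /eqP.
rewrite -lex0 leUx => /andP[h1 h2].
split; [have := vp_trans (f k x) w (f k (vl_join x y))
       |have := vp_trans (f k y) w (f k (vl_join x y))];
  by move=> /le_trans; apply; rewrite f_d join_l // (le_trans _ (le0x _)).
Qed.

Lemma f_mono k w x y : vp_d (f k (vl_meet x y)) w <= vp_d (f k x) w /\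
  vp_d (f k (vl_meet x y)) w <= vp_d (f k y) w.
Proof.
have := vl_refl (vl_meet x y); rewrite vl_meetE => /eqP.
rewrite -lex0 leUx => /andP[h1 h2].
split; [have := vp_trans (f k x) (f k (vl_meet x y)) w
       |have := vp_trans (f k y) (f k (vl_meet x y)) w];
  by move=> /le_trans; apply; rewrite f_d join_r // (le_trans _ (le0x _)).
Qed.

(** Towards another component each member of [X] has its own infimum over [T]. Finitely many
    intermediate points are replaced by their join, which is further up for all members of [X] and
    which [f_join] controls on the other side. *)
Lemma amalgam_join_lub Y b q s : amalgam_join Y b ->
  (forall p, Y p -> amalgam_d p q <= s) -> amalgam_d b q <= s.
Proof.
move=> [k [X [a [Xa -> ->]]]] {Y b}; case: q => l y hs.
have {}hs x : X x -> amalgam_d (inj x) (inj y) <= s by move=> Xx; apply: hs; exists x.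
have [kl|kl] := eqVneq k l.
  subst l; rewrite amalgam_dE; apply: vp_join_lub Xa _ => x /hs.
  by rewrite amalgam_dE.
have [finX X0] := W_join_fin Xa.
apply: (@finite_inf_directed _ _ _ _ (fun x z => vp_d x (f k z))
  (fun z => vp_d (f l z) y) (fun x => amalgam_d (inj x) (inj y)) vl_join
  _ _ _ _ X) => //.
- by move=> x z z'; case: (f_anti x z z').
- by move=> x z z'; case: (f_anti x z z').
- by move=> x m r; apply: amalgam_d_glb.
- move=> z r hr gr; apply: le_trans (amalgam_d_le _ _ z) _ => /=.
  by rewrite lexU2 // leUx gr (vp_join_lub Xa hr).
Qed.

Lemma amalgam_meet_glb Y b q s : amalgam_meet Y b ->
  (forall p, Y p -> amalgam_d q p <= s) -> amalgam_d q b <= s.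
Proof.
move=> [k [X [a [Xa -> ->]]]] {Y b}; case: q => l y hs.
have {}hs x : X x -> amalgam_d (inj y) (inj x) <= s by move=> Xx; apply: hs; exists x.
have [kl|kl] := eqVneq l k.
  subst l; rewrite amalgam_dE; apply: vp_meet_glb Xa _ => x /hs.
  by rewrite amalgam_dE.
have [finX X0] := W_meet_fin Xa.
apply: (@finite_inf_directed _ _ _ _ (fun x z => vp_d (f k z) x)
  (fun z => vp_d y (f l z)) (fun x => amalgam_d (inj y) (inj x)) vl_meet
  _ _ _ _ X) => //.
- by move=> x z z'; case: (f_mono x z z').
- by move=> x z z'; case: (f_mono x z z').
- move=> x m r h; apply: amalgam_d_glb => // z.
  by rewrite [vp_d y _ `|` _]joinC.
- move=> z r hr gr; apply: le_trans (amalgam_d_le _ _ z) _ => /=.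
  by rewrite lexU2 // leUx gr (vp_meet_glb Xa hr).
Qed.

Definition amalgam : vplat S :=
  VPlat (inj (f k0 vl_pt)) amalgam_refl amalgam_trans
    amalgam_join_ub amalgam_join_lub amalgam_meet_lb amalgam_meet_glb.

Lemma amalgam_base k l z : amalgam_d (inj (f k z)) (inj (f l z)) = \bot.
Proof.
apply/eqP; rewrite -lex0; apply: le_trans (amalgam_d_le _ _ z) _ => /=.
by rewrite !vp_refl joinx0.
Qed.

End Amalgam.

(** * Realizing all cuts *)

Section Cuts.
Variables (d : Order.disp_t) (S : bLatticeType d).

(** [I x] and [F y] are the values intended for the distances from [x] to a new point and from that
    point to [y]; [cut_d] is transitivity through it. *)
Record is_cut (T : vlat S) (I F : T -> S) : Prop := IsCut {
  cut_le : forall x y, I x <= vl_d x y `|` I y;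
  cut_join : forall x y, I (vl_join x y) <= I x `|` I y;
  cut_ge : forall x y, F y <= F x `|` vl_d x y;
  cut_meet : forall x y, F (vl_meet x y) <= F x `|` F y;
  cut_d : forall x y, vl_d x y <= I x `|` F y
}.

(* [c] is the join of [b] and of the element defined by the cut. *)
Definition cut_join_cond (T : vlat S) (I F : T -> S) (b c : T) : Prop :=
  [/\ vl_d b c = \bot, F c = \bot, I c <= I b
    & forall y, vl_d c y <= vl_d b y `|` F y].

Definition cut_meet_cond (T : vlat S) (I F : T -> S) (b a : T) : Prop :=
  [/\ vl_d a b = \bot, I a = \bot, F a <= F b
    & forall y, vl_d y a <= vl_d y b `|` I y].

(** * Adjoining one point that realizes a cut *)

Section OnePoint.
Variables (T : vlat S) (I F : T -> S).
Hypothesis cutIF : is_cut I F.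

Definition one_point_d (u v : option T) : S :=
  match u, v with
  | Some x, Some y => vl_d x y
  | Some x, None => I x
  | None, Some y => F y
  | None, None => \bot
  end.

Definition one_point_join (X : set (option T)) (a : option T) : Prop :=
  (exists x y, X = [set Some x; Some y] /\ a = Some (vl_join x y)) \/
  (exists b c, [/\ X = [set Some b; None], a = Some c & cut_join_cond I F b c]).

Definition one_point_meet (X : set (option T)) (a : option T) : Prop :=
  (exists x y, X = [set Some x; Some y] /\ a = Some (vl_meet x y)) \/
  (exists b c, [/\ X = [set Some b; None], a = Some c & cut_meet_cond I F b c]).

Lemma one_point_refl u : one_point_d u u = \bot.
Proof. by case: u => //= x; rewrite vl_refl. Qed.

Lemma one_point_trans v u w :
  one_point_d u w <= one_point_d u v `|` one_point_d v w.
Proof.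
case: cutIF => Il Ij Fl Fm Id.
case: u v w => [x|] [y|] [z|] //=; try exact: vl_trans; try join_le.
Qed.

Lemma vl_join_ub (x y : T) :
  vl_d x (vl_join x y) = \bot /\ vl_d y (vl_join x y) = \bot.
Proof.
have := vl_refl (vl_join x y); rewrite vl_joinE => /eqP.
by rewrite -lex0 leUx !lex0 => /andP[/eqP-> /eqP->].
Qed.

Lemma vl_meet_lb (x y : T) :
  vl_d (vl_meet x y) x = \bot /\ vl_d (vl_meet x y) y = \bot.
Proof.
have := vl_refl (vl_meet x y); rewrite vl_meetE => /eqP.
by rewrite -lex0 leUx !lex0 => /andP[/eqP-> /eqP->].
Qed.

Lemma one_point_join_ub X a u :
  one_point_join X a -> X u -> one_point_d u a = \bot.
Proof.
move=> [[x [y [-> ->]]]|[b [c [-> -> [bc Fc _ _]]]]] [] -> //=.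
  by case: (vl_join_ub x y).
by case: (vl_join_ub x y).
Qed.

Lemma one_point_meet_lb X a u :
  one_point_meet X a -> X u -> one_point_d a u = \bot.
Proof.
move=> [[x [y [-> ->]]]|[b [c [-> -> [bc Fc _ _]]]]] [] -> //=.
  by case: (vl_meet_lb x y).
by case: (vl_meet_lb x y).
Qed.

Lemma one_point_join_lub X a b s : one_point_join X a ->
  (forall x, X x -> one_point_d x b <= s) -> one_point_d a b <= s.
Proof.
move=> [[x [y [-> ->]]]|[e [c [-> -> [bc Fc Ic dc]]]]] h.
  have := h (Some x) (or_introl erefl); have := h (Some y) (or_intror erefl).
  case: b {h} => [z|] /= h1 h2; first by rewrite vl_joinE leUx h2.
  by apply: le_trans (cut_join cutIF _ _) _; rewrite leUx h2.
have := h (Some e) (or_introl erefl); have := h None (or_intror erefl).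
case: b {h} => [z|] /= h1 h2; last exact: le_trans h2.
by apply: le_trans (dc z) _; rewrite leUx h2.
Qed.

Lemma one_point_meet_glb X a b s : one_point_meet X a ->
  (forall x, X x -> one_point_d b x <= s) -> one_point_d b a <= s.
Proof.
move=> [[x [y [-> ->]]]|[e [c [-> -> [bc Fc Ic dc]]]]] h.
  have := h (Some x) (or_introl erefl); have := h (Some y) (or_intror erefl).
  case: b {h} => [z|] /= h1 h2; first by rewrite vl_meetE leUx h2.
  by apply: le_trans (cut_meet cutIF _ _) _; rewrite leUx h2.
have := h (Some e) (or_introl erefl); have := h None (or_intror erefl).
case: b {h} => [z|] /= h1 h2; last exact: le_trans h2.
by apply: le_trans (dc z) _; rewrite leUx h2.
Qed.

Definition one_point : vplat S :=
  VPlat None one_point_refl one_point_trans one_point_join_ub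
    one_point_join_lub one_point_meet_lb one_point_meet_glb.

End OnePoint.

Hypothesis S_ccB : conditionally_co_Brouwerian S.
Variable T : vlat S.

Definition cut := {k : (T -> S) * (T -> S) | is_cut k.1 k.2}.

Lemma principal_cut (z : T) : is_cut (vl_d ^~ z) (vl_d z).
Proof.
split=> x y; try exact: vl_trans; first by rewrite vl_joinE.
by rewrite vl_meetE.
Qed.

(** Makes the family of cuts nonempty and fixes one copy of [T] inside the amalgam. *)
Definition cut0 : cut := exist _ (_, _) (principal_cut vl_pt).

Definition all_cuts_fam (k : {classic cut}) : vplat S := one_point (proj2_sig k).

Definition all_cuts_base (k : {classic cut}) (x : T) : all_cuts_fam k := Some x.

Lemma all_cuts_base_d k x y :
  vp_d (all_cuts_base k x) (all_cuts_base k y) = vl_d x y.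
Proof. by []. Qed.

Lemma all_cuts_base_join k x y w : vp_d (all_cuts_base k (vl_join x y)) w <=
  vp_d (all_cuts_base k x) w `|` vp_d (all_cuts_base k y) w.
Proof.
apply: (@vp_join_lub _ _ _ [set all_cuts_base k x; all_cuts_base k y]).
  by left; exists x, y.
by move=> _ [] ->; [exact: leUl|exact: leUr].
Qed.

Lemma all_cuts_base_meet k x y w : vp_d w (all_cuts_base k (vl_meet x y)) <=
  vp_d w (all_cuts_base k x) `|` vp_d w (all_cuts_base k y).
Proof.
apply: (@vp_meet_glb _ _ _ [set all_cuts_base k x; all_cuts_base k y]).
  by left; exists x, y.
by move=> _ [] ->; [exact: leUl|exact: leUr].
Qed.

Lemma all_cuts_join_fin k (X : set (all_cuts_fam k)) a :
  vp_join X a -> finite_set X /\ X !=set0.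
Proof.
by move=> [[x [y [-> _]]]|[b [c [-> _ _]]]]; split;
  [exact: finite_set2|exists (Some x); left|exact: finite_set2|exists None; right].
Qed.

Lemma all_cuts_meet_fin k (X : set (all_cuts_fam k)) a :
  vp_meet X a -> finite_set X /\ X !=set0.
Proof.
by move=> [[x [y [-> _]]]|[b [c [-> _ _]]]]; split;
  [exact: finite_set2|exists (Some x); left|exact: finite_set2|exists None; right].
Qed.

Definition all_cuts : vplat S :=
  amalgam S_ccB (cut0 : {classic cut}) all_cuts_base_d
    all_cuts_base_join all_cuts_base_meet
    all_cuts_join_fin all_cuts_meet_fin.

Definition extension : vlat S := ideal_vlat S_ccB all_cuts.

Definition ext_base (k : cut) (x : T) : extension :=
  pideal (W := all_cuts) (existT _ (k : {classic cut}) (Some x)).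

Definition ext_emb (x : T) : extension := ext_base cut0 x.

Definition ext_new (k : cut) : extension :=
  pideal (W := all_cuts) (existT _ (k : {classic cut}) None).

(** Each cut has its own copy of [T] in the amalgam; the copies are identified only up to distance
    [\bot]. *)
Lemma ext_base_le k l x : vl_d (ext_base k x) (ext_base l x) = \bot.
Proof.
rewrite [LHS](pidealE S_ccB); exact: (amalgam_base S_ccB all_cuts_base k l x).
Qed.

Lemma vl_equivl (U : vlat S) (x y z : U) :
  vl_d x y = \bot -> vl_d y x = \bot -> vl_d x z = vl_d y z.
Proof.
move=> xy yx; apply/eqP; rewrite eq_le.
by rewrite (le_trans (vl_trans y _ _)) ?xy ?join0x //
  (le_trans (vl_trans x _ _)) ?yx ?join0x.
Qed.

Lemma vl_equivr (U : vlat S) (x y z : U) :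
  vl_d x y = \bot -> vl_d y x = \bot -> vl_d z x = vl_d z y.
Proof.
move=> xy yx; apply/eqP; rewrite eq_le.
by rewrite (le_trans (vl_trans y _ _)) ?yx ?joinx0 //
  (le_trans (vl_trans x _ _)) ?xy ?joinx0.
Qed.

Lemma ext_basel k l x z : vl_d (ext_base k x) z = vl_d (ext_base l x) z.
Proof. by apply: vl_equivl; rewrite ext_base_le. Qed.

Lemma ext_baser k l x z : vl_d z (ext_base k x) = vl_d z (ext_base l x).
Proof. by apply: vl_equivr; rewrite ext_base_le. Qed.

Lemma ext_embE x y : vl_d (ext_emb x) (ext_emb y) = vl_d x y.
Proof.
rewrite [LHS](pidealE S_ccB).
exact: (@amalgam_dE _ _ S_ccB _ _ all_cuts_fam all_cuts_base (cut0 : {classic cut})).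
Qed.

(** Once the copy of [x] is exchanged for that in component [k], both points lie in this component,
    whose distance the amalgam preserves. *)
Lemma ext_newl k x : vl_d (ext_new k) (ext_emb x) = (sval k).2 x.
Proof.
rewrite (ext_baser _ k) [LHS](pidealE S_ccB).
exact: (@amalgam_dE _ _ S_ccB _ _ all_cuts_fam all_cuts_base (k : {classic cut})).
Qed.

Lemma ext_newr k x : vl_d (ext_emb x) (ext_new k) = (sval k).1 x.
Proof.
rewrite (ext_basel _ k) [LHS](pidealE S_ccB).
exact: (@amalgam_dE _ _ S_ccB _ _ all_cuts_fam all_cuts_base (k : {classic cut})).
Qed.

Lemma all_cuts_join k (X : set (option T)) a :
  one_point_join (sval k).1 (sval k).2 X a ->
  vp_join (v := all_cuts)
    [set existT (fun k => vp_sort (all_cuts_fam k)) (k : {classic cut}) u | u in X]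
    (existT _ (k : {classic cut}) a).
Proof. by move=> Xa; exists k, X, a. Qed.

Lemma all_cuts_meet k (X : set (option T)) a :
  one_point_meet (sval k).1 (sval k).2 X a ->
  vp_meet (v := all_cuts)
    [set existT (fun k => vp_sort (all_cuts_fam k)) (k : {classic cut}) u | u in X]
    (existT _ (k : {classic cut}) a).
Proof. by move=> Xa; exists k, X, a. Qed.

Lemma ext_join_le k b c z : cut_join_cond (sval k).1 (sval k).2 b c ->
  vl_d (ext_emb c) z <= vl_d (ext_emb b) z `|` vl_d (ext_new k) z.
Proof.
move=> bc; rewrite (ext_basel _ k c) (ext_basel _ k b).
apply: (pideal_join_lub S_ccB (W := all_cuts)
  (X := [set existT _ (k : {classic cut}) u | u in [set Some b; None]])).
  by apply: all_cuts_join; right; exists b, c.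
by move=> _ [_ [->|->] <-]; [exact: leUl|exact: leUr].
Qed.

Lemma ext_meet_ge k b c z : cut_meet_cond (sval k).1 (sval k).2 b c ->
  vl_d z (ext_emb c) <= vl_d z (ext_emb b) `|` vl_d z (ext_new k).
Proof.
move=> bc; rewrite (ext_baser _ k c) (ext_baser _ k b).
apply: (pideal_meet_glb S_ccB (W := all_cuts)
  (X := [set existT _ (k : {classic cut}) u | u in [set Some b; None]])).
  by apply: all_cuts_meet; right; exists b, c.
by move=> _ [_ [->|->] <-]; [exact: leUl|exact: leUr].
Qed.

Lemma ext_embJ x y z : vl_d (ext_emb (vl_join x y)) z =
  vl_d (ext_emb x) z `|` vl_d (ext_emb y) z.
Proof.
apply/eqP; rewrite eq_le; apply/andP; split.
  apply: (pideal_join_lub S_ccB (W := all_cuts)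
    (X := [set existT _ (cut0 : {classic cut}) u | u in [set Some x; Some y]])).
    by apply: all_cuts_join; left; exists x, y.
  by move=> _ [_ [->|->] <-]; [exact: leUl|exact: leUr].
have [xj yj] := vl_join_ub x y.
rewrite leUx; apply/andP; split;
  apply: le_trans (vl_trans (ext_emb (vl_join x y)) _ _) _;
  by rewrite ext_embE ?xj ?yj join0x.
Qed.

Lemma ext_embM x y z : vl_d z (ext_emb (vl_meet x y)) =
  vl_d z (ext_emb x) `|` vl_d z (ext_emb y).
Proof.
apply/eqP; rewrite eq_le; apply/andP; split.
  apply: (pideal_meet_glb S_ccB (W := all_cuts)
    (X := [set existT _ (cut0 : {classic cut}) u | u in [set Some x; Some y]])).
    by apply: all_cuts_meet; left; exists x, y.
  by move=> _ [_ [->|->] <-]; [exact: leUl|exact: leUr].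
have [xj yj] := vl_meet_lb x y.
rewrite leUx; apply/andP; split;
  apply: le_trans (vl_trans (ext_emb (vl_meet x y)) _ _) _;
  by rewrite ext_embE ?xj ?yj joinx0.
Qed.

End Cuts.

(** * Iterated extension *)

Section Limit.
Variables (d : Order.disp_t) (S : bLatticeType d).
Hypothesis S_ccB : conditionally_co_Brouwerian S.

(** The cut is prescribed on all of [T] but is matched only on [xs]: a finite list lies in one level
    of the tower, and a point added just above follows the cut on that level. *)
Definition rich (T : vlat S) : Prop :=
  forall (xs : seq T) (I F : T -> S), is_cut I F -> exists t,
  [/\ forall x, List.In x xs -> vl_d x t = I x /\ vl_d t x = F x,
      forall b c, List.In b xs -> List.In c xs -> cut_join_cond I F b c ->
        vl_d c (vl_join b t) = \bot
    & forall b a, List.In b xs -> List.In a xs -> cut_meet_cond I F b a ->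
        vl_d (vl_meet b t) a = \bot].

Variable T : vlat S.

Fixpoint level (n : nat) : vlat S :=
  if n is m.+1 then extension S_ccB (level m) else T.

Definition up n : level n -> level n.+1 := @ext_emb _ _ S_ccB (level n).

(* [lift m x] is the image of [x : level n] in [level m] when [n <= m], and is
   irrelevant otherwise. *)
Fixpoint lift (m n : nat) : level n -> level m :=
  match pselect (n = m) with
  | left e => fun x => eq_rect n (fun k => vl_sort (level k)) x m e
  | right _ => match m with
               | 0 => fun=> vl_pt
               | m'.+1 => fun x => up (lift m' x)
               end
  end.

Lemma lift_id n (x : level n) : lift n x = x.
Proof.
by case: n x => [|n] x /=; case: pselect => // e; rewrite (Prop_irrelevance e erefl).
Qed.

Lemma lift_up n m (x : level n) : (n <= m)%N -> lift m.+1 x = up (lift m x).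
Proof.
by move=> nm; rewrite /lift; case: pselect => // e; exfalso;
  have := nm; rewrite [n]e ltnn.
Qed.

Lemma lift_trans n m k (x : level n) : (n <= m)%N -> (m <= k)%N ->
  lift k (lift m x) = lift k x.
Proof.
move=> nm; elim: k => [|k IH] mk.
  by move: mk; rewrite leqn0 => /eqP m0; subst m; rewrite lift_id.
move: mk; rewrite leq_eqVlt => /predU1P[mk|mk]; first by subst m; rewrite lift_id.
by rewrite !lift_up ?IH // (leq_trans nm).
Qed.

Lemma lift_d n m (x y : level n) : (n <= m)%N ->
  vl_d (lift m x) (lift m y) = vl_d x y.
Proof.
elim: m => [|m IH] nm.
  by move: nm; rewrite leqn0 => /eqP n0; subst n; rewrite !lift_id.
move: nm; rewrite leq_eqVlt => /predU1P[nm|nm]; first by subst n; rewrite !lift_id.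
by rewrite !lift_up // ext_embE IH.
Qed.

Lemma lift_join n m (x y : level n) z : (n <= m)%N ->
  vl_d (lift m (vl_join x y)) z = vl_d (lift m x) z `|` vl_d (lift m y) z.
Proof.
elim: m z => [|m IH] z nm.
  by move: nm; rewrite leqn0 => /eqP n0; subst n; rewrite !lift_id vl_joinE.
move: nm; rewrite leq_eqVlt => /predU1P[nm|nm].
  by subst n; rewrite !lift_id vl_joinE.
(* By induction the lift of the join is equivalent to the join of the lifts, and [ext_emb] preserves
   this equivalence. *)
rewrite !lift_up // /up -ext_embJ; apply: vl_equivl; rewrite ext_embE.
  by rewrite IH // -vl_joinE vl_refl.
by rewrite vl_joinE -IH // vl_refl.
Qed.

Lemma lift_meet n m (x y : level n) z : (n <= m)%N ->
  vl_d z (lift m (vl_meet x y)) = vl_d z (lift m x) `|` vl_d z (lift m y).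
Proof.
elim: m z => [|m IH] z nm.
  by move: nm; rewrite leqn0 => /eqP n0; subst n; rewrite !lift_id vl_meetE.
move: nm; rewrite leq_eqVlt => /predU1P[nm|nm].
  by subst n; rewrite !lift_id vl_meetE.
rewrite !lift_up // /up -ext_embM; apply: vl_equivr; rewrite ext_embE.
  by rewrite vl_meetE -IH // vl_refl.
by rewrite IH // -vl_meetE vl_refl.
Qed.

(** The direct limit is a disjoint union without identifications; a point and its lifts are at
    distance [\bot] both ways, which suffices in a [vlat]. *)
Definition lim_sort := {n : nat & level n}.
Definition lim_in n (x : level n) : lim_sort :=
  existT (fun k => vl_sort (level k)) n x.
Implicit Types p q r : lim_sort.

Definition lim_d p q : S := let k := maxn (projT1 p) (projT1 q) in
  vl_d (lift k (projT2 p)) (lift k (projT2 q)).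

Lemma lim_dE k p q : (projT1 p <= k)%N -> (projT1 q <= k)%N ->
  lim_d p q = vl_d (lift k (projT2 p)) (lift k (projT2 q)).
Proof.
move=> pk qk; set m := maxn (projT1 p) (projT1 q).
have mk : (m <= k)%N by rewrite geq_max pk.
rewrite -(@lift_trans _ m k (projT2 p)) ?leq_maxl //.
by rewrite -(@lift_trans _ m k (projT2 q)) ?leq_maxr // lift_d.
Qed.

Lemma lim_in_d n (x y : level n) : lim_d (lim_in x) (lim_in y) = vl_d x y.
Proof. by rewrite (@lim_dE n) //= !lift_id. Qed.

Lemma lim_refl p : lim_d p p = \bot.
Proof. by rewrite /lim_d vl_refl. Qed.

Lemma lim_lift k p : (projT1 p <= k)%N ->
  lim_d p (lim_in (lift k (projT2 p))) = \bot /\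
  lim_d (lim_in (lift k (projT2 p))) p = \bot.
Proof. by move=> pk; rewrite !(@lim_dE k) //= lift_id vl_refl. Qed.

Lemma lim_trans q p r : lim_d p r <= lim_d p q `|` lim_d q r.
Proof.
pose k := maxn (maxn (projT1 p) (projT1 q)) (projT1 r).
have [pk qk rk] : [/\ projT1 p <= k, projT1 q <= k & projT1 r <= k]%N.
  by rewrite /k !leq_max !leqnn !orbT.
by rewrite !(@lim_dE k) // vl_trans.
Qed.

Definition lim_join p q : lim_sort := let k := maxn (projT1 p) (projT1 q) in
  lim_in (vl_join (lift k (projT2 p)) (lift k (projT2 q))).

Definition lim_meet p q : lim_sort := let k := maxn (projT1 p) (projT1 q) in
  lim_in (vl_meet (lift k (projT2 p)) (lift k (projT2 q))).

Lemma lim_in_join n (x y : level n) r :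
  lim_d (lim_in (vl_join x y)) r = lim_d (lim_in x) r `|` lim_d (lim_in y) r.
Proof.
pose k := maxn n (projT1 r).
have [nk rk] : (n <= k)%N /\ (projT1 r <= k)%N by rewrite /k leq_maxl leq_maxr.
by rewrite !(@lim_dE k) //= lift_join.
Qed.

Lemma lim_in_meet n (x y : level n) r :
  lim_d r (lim_in (vl_meet x y)) = lim_d r (lim_in x) `|` lim_d r (lim_in y).
Proof.
pose k := maxn n (projT1 r).
have [nk rk] : (n <= k)%N /\ (projT1 r <= k)%N by rewrite /k leq_maxl leq_maxr.
by rewrite !(@lim_dE k) //= lift_meet.
Qed.

Lemma lim_equivl p q r : lim_d p q = \bot -> lim_d q p = \bot ->
  lim_d p r = lim_d q r.
Proof.
move=> pq qp; apply/eqP; rewrite eq_le.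
by rewrite (le_trans (lim_trans q _ _)) ?pq ?join0x //
  (le_trans (lim_trans p _ _)) ?qp ?join0x.
Qed.

Lemma lim_equivr p q r : lim_d p q = \bot -> lim_d q p = \bot ->
  lim_d r p = lim_d r q.
Proof.
move=> pq qp; apply/eqP; rewrite eq_le.
by rewrite (le_trans (lim_trans q _ _)) ?qp ?joinx0 //
  (le_trans (lim_trans p _ _)) ?pq ?joinx0.
Qed.

Lemma lim_joinE p q r : lim_d (lim_join p q) r = lim_d p r `|` lim_d q r.
Proof.
rewrite lim_in_join; congr (_ `|` _); apply: lim_equivl;
  by case: (@lim_lift _ _ (leq_maxl (projT1 p) (projT1 q)));
     case: (@lim_lift _ _ (leq_maxr (projT1 p) (projT1 q))).
Qed.

Lemma lim_meetE p q r : lim_d r (lim_meet p q) = lim_d r p `|` lim_d r q.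
Proof.
rewrite lim_in_meet; congr (_ `|` _); apply: lim_equivr;
  by case: (@lim_lift _ _ (leq_maxl (projT1 p) (projT1 q)));
     case: (@lim_lift _ _ (leq_maxr (projT1 p) (projT1 q))).
Qed.

Definition limit : vlat S :=
  VLat (lim_in (n := 0) vl_pt) lim_refl lim_trans lim_joinE lim_meetE.

(** All of [xs] comes from one level [n]; the cut restricts to that level and is realized by its new
    point in level [n.+1]. *)
Lemma limit_rich : rich limit.
Proof.
move=> xs I F cutIF; have [Il Ij Fl Fm Id] := cutIF.
have [n hn] : exists n, forall x, List.In x xs -> (projT1 x <= n)%N.
  elim: xs => [|x xs [n hn]]; first by exists 0%N.
  exists (maxn (projT1 x) n) => y [<-|/hn yn]; first exact: leq_maxl.
  by rewrite leq_max yn orbT.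
have Ieq (p q : limit) : vl_d p q = \bot -> vl_d q p = \bot -> I p = I q /\ F p = F q.
  move=> pq qp; split; apply/eqP; rewrite eq_le.
    by have := Il p q; have := Il q p; rewrite pq qp !join0x => -> ->.
  by have := Fl p q; have := Fl q p; rewrite pq qp !joinx0 => -> ->.
have vjoin (p q r : limit) : (forall z : limit, vl_d p z = vl_d q z `|` vl_d r z) ->
    vl_d p (vl_join q r) = \bot /\ vl_d (vl_join q r) p = \bot.
  move=> h; split; last by rewrite vl_joinE -h vl_refl.
  by rewrite h; have [-> ->] := vl_join_ub q r; rewrite joinx0.
have vmeet (p q r : limit) : (forall z : limit, vl_d z p = vl_d z q `|` vl_d z r) ->
    vl_d (vl_meet q r) p = \bot /\ vl_d p (vl_meet q r) = \bot.
  move=> h; split; last by rewrite vl_meetE -h vl_refl.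
  by rewrite h; have [-> ->] := vl_meet_lb q r; rewrite joinx0.
(* A join taken in level [n] is only equivalent to the join taken in the limit, so [I] and [F] must
   respect equivalence, as [Ieq] shows. *)
have cutn : is_cut (fun x : level n => I (lim_in x)) (fun x => F (lim_in x)).
  split=> x y /=; try by rewrite -lim_in_d.
  - have [h h'] := vjoin (lim_in (vl_join x y)) (lim_in x) (lim_in y) (lim_in_join x y).
    by have [-> _] := Ieq _ _ h h'.
  - have [h h'] := vmeet (lim_in (vl_meet x y)) (lim_in x) (lim_in y) (lim_in_meet x y).
    by have [_ <-] := Ieq _ _ h h'.
pose k : cut (level n) := exist _ (_, _) cutn.
pose t : level n.+1 := ext_new S_ccB k.
have emb (p : limit) : List.In p xs -> let q := lim_in (up (lift n (projT2 p))) in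
    lim_d p q = \bot /\ lim_d q p = \bot.
  move=> /hn pn; rewrite -lift_up //; apply: lim_lift.
  exact: leq_trans pn (leqnSn n).
have low (p : limit) : List.In p xs ->
    I p = I (lim_in (lift n (projT2 p))) /\ F p = F (lim_in (lift n (projT2 p))).
  by move=> /hn pn; have [h h'] := lim_lift pn; apply: Ieq.
have cut_low (p : limit) (z : level n) : List.In p xs ->
    vl_d (lift n (projT2 p)) z = vl_d p (lim_in z : limit) /\
    vl_d z (lift n (projT2 p)) = vl_d (lim_in z : limit) p.
  move=> /hn pn; have [h h'] := lim_lift pn; rewrite -!lim_in_d.
  by split; [exact: lim_equivl|exact: lim_equivr].
exists (lim_in t); split.
- move=> x xin; have [h h'] := emb x xin; have [-> ->] := low x xin; split.
    by rewrite [LHS](lim_equivl _ h h') lim_in_d [LHS]ext_newr.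
  by rewrite [LHS](lim_equivr _ h h') lim_in_d [LHS]ext_newl.
- move=> b c bin cin [bc Fc Ic dc].
  pose b' := lift n (projT2 b); pose c' := lift n (projT2 c).
  have [hb hb'] := emb b bin; have [hc hc'] := emb c cin.
  have bc' : cut_join_cond (sval k).1 (sval k).2 b' c'.
    have [hI hF] := low _ cin; have [hI' hF'] := low _ bin.
    split=> /=; rewrite -?hI -?hF -?hI' -?hF' //.
      by rewrite (cut_low b _ bin).1 -bc; apply: lim_equivr;
        case: (lim_lift (hn c cin)).
    by move=> y; rewrite (cut_low b _ bin).1 (cut_low c _ cin).1.
  apply/eqP; rewrite -lex0.
  (* Passes through the join formed inside level [n.+1], where [c'] is declared to be the join of
     [b'] and the new point. *)
  apply: le_trans (lim_trans (lim_in (vl_join (up b') t)) _ _) _.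
  rewrite leUx lim_in_join leUx; apply/and3P; split.
  + rewrite (lim_equivl _ hc hc') lim_in_d.
    apply: le_trans (ext_join_le _ bc') _.
    by rewrite -vl_joinE vl_refl.
  + rewrite -(lim_equivl _ hb hb').
    by rewrite lex0; apply/eqP; case: (vl_join_ub (b : limit) (lim_in t)).
  + by rewrite lex0; apply/eqP; case: (vl_join_ub (b : limit) (lim_in t)).
- move=> b c bin cin [bc Fc Ic dc].
  pose b' := lift n (projT2 b); pose c' := lift n (projT2 c).
  have [hb hb'] := emb b bin; have [hc hc'] := emb c cin.
  have bc' : cut_meet_cond (sval k).1 (sval k).2 b' c'.
    have [hI hF] := low _ cin; have [hI' hF'] := low _ bin.
    split=> /=; rewrite -?hI -?hF -?hI' -?hF' //.
      by rewrite (cut_low b _ bin).2 -bc; apply: lim_equivl;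
        case: (lim_lift (hn c cin)).
    by move=> y; rewrite (cut_low b _ bin).2 (cut_low c _ cin).2.
  apply/eqP; rewrite -lex0.
  apply: le_trans (lim_trans (lim_in (vl_meet (up b') t)) _ _) _.
  rewrite leUx lim_in_meet leUx -andbA; apply/and3P; split.
  + rewrite -(lim_equivr _ hb hb').
    by rewrite lex0; apply/eqP; case: (vl_meet_lb (b : limit) (lim_in t)).
  + by rewrite lex0; apply/eqP; case: (vl_meet_lb (b : limit) (lim_in t)).
  + rewrite (lim_equivr _ hc hc') lim_in_d.
    apply: le_trans (ext_meet_ge _ bc') _.
    by rewrite -vl_meetE vl_refl.
Qed.

End Limit.

(** * Consequences of richness *)

Section Rich.
Variables (d : Order.disp_t) (S : bLatticeType d).
Hypothesis S_ccB : conditionally_co_Brouwerian S.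
Variable T : vlat S.
Hypothesis T_rich : rich T.
Implicit Types (a b c o x y : T) (s : S).

Lemma le_joinI (z u p q : S) : z <= u `|` p -> z <= u `|` q -> z <= u `|` (p `&` q).
Proof. by move=> h h'; rewrite (ccB_joinI S_ccB) lexI h. Qed.

Lemma vl_d_transl a c y : vl_d a c = \bot -> vl_d a y <= vl_d c y.
Proof. by move=> ac; rewrite (le_trans (vl_trans c _ _)) // ac join0x. Qed.

(* The ideal and, in the next lemma, the filter of the cuts that define elements
   of the interval from [a] to [c]. *)
Lemma mixed_ideal a c s :
  (forall x y, vl_d x c `|` (s `&` vl_d x a) <=
    vl_d x y `|` (vl_d y c `|` (s `&` vl_d y a))) /\
  (forall x y, vl_d (vl_join x y) c `|` (s `&` vl_d (vl_join x y) a) <=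
    (vl_d x c `|` (s `&` vl_d x a)) `|` (vl_d y c `|` (s `&` vl_d y a))).
Proof.
split=> x y; last by rewrite !vl_joinE (ccB_meetU S_ccB); join_le.
rewrite leUx; apply/andP; split; first by apply: le_trans (vl_trans y _ _) _; join_le.
rewrite joinA; apply: le_joinI; first by rewrite lexU2 // leIl orbT.
by apply: le_trans (leIr _ _) _; apply: le_trans (vl_trans y _ _) _; join_le.
Qed.

Lemma mixed_filter a c s :
  (forall x y, vl_d a y `|` (s `&` vl_d c y) <=
    vl_d a x `|` (s `&` vl_d c x) `|` vl_d x y) /\
  (forall x y, vl_d a (vl_meet x y) `|` (s `&` vl_d c (vl_meet x y)) <=
    (vl_d a x `|` (s `&` vl_d c x)) `|` (vl_d a y `|` (s `&` vl_d c y))).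
Proof.
split=> x y; last by rewrite !vl_meetE (ccB_meetU S_ccB); join_le.
rewrite leUx; apply/andP; split; first by apply: le_trans (vl_trans x _ _) _; join_le.
rewrite joinAC; apply: le_joinI; first by rewrite lexU2 // leIl orbT.
by apply: le_trans (leIr _ _) _; apply: le_trans (vl_trans x _ _) _; join_le.
Qed.

(** In terms of truth values, [x <= t] means [x <= c] and ([b <= a] or [x <= a]), while [t <= y]
    means [a <= y] and ([c <= b] or [c <= y]). So [t] becomes [c] where [b] collapses to [a],
    becomes [a] where [c] collapses to [b], and is generic elsewhere. *)
Lemma rich_complement a b c : vl_d a b = \bot -> vl_d b c = \bot ->
  exists t, [/\ vl_d a t = \bot, vl_d t c = \bot,
    vl_d (vl_meet b t) a = \bot & vl_d c (vl_join b t) = \bot].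
Proof.
move=> ab bc; have ac : vl_d a c = \bot.
  by apply/eqP; rewrite -lex0 (le_trans (vl_trans b _ _)) // ab bc joinx0.
pose I x := vl_d x c `|` (vl_d b a `&` vl_d x a).
pose F y := vl_d a y `|` (vl_d c b `&` vl_d c y).
have cutIF : is_cut I F.
  have [Il Ij] := mixed_ideal a c (vl_d b a).
  have [Fl Fm] := mixed_filter a c (vl_d c b).
  split=> //; rewrite /I /F => x y.
  have -> : vl_d x c `|` (vl_d b a `&` vl_d x a) `|`
      (vl_d a y `|` (vl_d c b `&` vl_d c y)) =
    vl_d x c `|` vl_d a y `|` (vl_d c b `&` vl_d c y) `|` (vl_d b a `&` vl_d x a).
    by rewrite -!joinA; congr (_ `|` _); rewrite joinC -joinA.
  apply: le_joinI; last by apply: le_trans (vl_trans a _ _) _; join_le.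
  rewrite joinAC; apply: le_joinI; last by apply: le_trans (vl_trans c _ _) _; join_le.
  (* What remains carries [vl_d c b] and [vl_d b a], which pay for the path from [x] through [c],
     [b] and [a] to [y]. *)
  have h1 := vl_trans b c a; have h2 := vl_trans c x a; have h3 := vl_trans a x y.
  apply: le_trans h3 _; rewrite leUx; apply/andP; split; last join_le.
  apply: le_trans h2 _; rewrite leUx; apply/andP; split; first join_le.
  by apply: le_trans h1 _; join_le.
have [t [td tj tm]] := T_rich [:: a; b; c] cutIF.
have [ain bin cin] : [/\ List.In a [:: a; b; c], List.In b [:: a; b; c]
    & List.In c [:: a; b; c]].
  by split=> /=; auto.
have [dat _] := td a ain; have [_ dtc] := td c cin.
exists t; split.
- by rewrite dat /I ac vl_refl meetx0 join0x.
- by rewrite dtc /F ac vl_refl meetx0 join0x.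
- apply: tm => //; split=> //; rewrite /I /F.
  + by rewrite ac vl_refl meetx0 join0x.
  + by rewrite vl_refl ab !join0x meetxx leIl.
  + move=> y; rewrite joinA; apply: le_joinI; last join_le.
    by apply: le_trans (vl_trans b _ _) _; join_le.
- apply: tj => //; split=> //; rewrite /I /F.
  + by rewrite ac vl_refl meetx0 join0x.
  + by rewrite vl_refl bc !join0x meetxx leIl.
  + move=> y; rewrite joinA; apply: le_joinI; last join_le.
    by apply: le_trans (vl_trans b _ _) _; join_le.
Qed.

(* Both elements realize the cut of a generic element between [a] and [c]; the
   second one is chosen generic over the first. *)
Lemma rich_M3 a b c : vl_d a b = \bot -> vl_d b c = \bot ->
  vl_d c a <= vl_d b a -> exists p q,
  [/\ vl_d a p = \bot /\ vl_d p c = \bot, vl_d a q = \bot /\ vl_d q c = \bot,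
      vl_d c (vl_join b p) = \bot, vl_d c (vl_join b q) = \bot
    & vl_d (vl_meet p q) a = \bot].
Proof.
move=> ab bc cab; have ac : vl_d a c = \bot.
  by apply/eqP; rewrite -lex0 (le_trans (vl_trans b _ _)) // ab bc joinx0.
have cutIF : is_cut (vl_d ^~ a) (vl_d c).
  split=> x y; rewrite ?vl_joinE ?vl_meetE //; try exact: vl_trans.
  apply: le_trans (vl_trans a x y) _; rewrite leU2 //.
  exact: vl_d_transl.
(* The clause [I c <= I b] is the hypothesis [cab]. *)
have bcj : cut_join_cond (vl_d ^~ a) (vl_d c) b c.
  by split=> // [|y]; [rewrite vl_refl|rewrite leUr].
have [p [pd pj _]] := T_rich [:: a; b; c] cutIF.
(* With [p] in the list, the meet clause can be used for [p] and [q]; its condition [F a <= F p]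
   holds as [vl_d c p = vl_d c a]. *)
have [q [qd qj qm]] := T_rich [:: a; b; c; p] cutIF.
have [dap _] : vl_d a p = vl_d a a /\ vl_d p a = vl_d c a by apply: pd; left.
have [daq _] : vl_d a q = vl_d a a /\ vl_d q a = vl_d c a by apply: qd; left.
have [dcp dpc] : vl_d c p = vl_d c a /\ vl_d p c = vl_d c c by apply: pd => /=; auto.
have [dcq dqc] : vl_d c q = vl_d c a /\ vl_d q c = vl_d c c by apply: qd => /=; auto.
exists p, q; rewrite dap daq dpc dqc !vl_refl; split=> //.
- by apply: pj => //=; auto.
- by apply: qj => //=; auto.
- apply: qm => /=; auto; split; rewrite ?vl_refl ?dap ?dcp ?vl_refl // => y.
  by rewrite leUr.
Qed.

(** The filter is that of [o], and the ideal is that of [o] raised by [s]: the new point becomes [o]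
    exactly when [s] is collapsed. *)
Lemma rich_below o s : exists t, vl_d t o = \bot /\ vl_d o t = s.
Proof.
have cutIF : is_cut (fun x => vl_d x o `|` s) (vl_d o).
  split=> x y; rewrite ?vl_joinE ?vl_meetE //; try exact: vl_trans.
  - by have := vl_trans y x o => h; rewrite joinA leU2.
  - join_le.
  - by apply: le_trans (vl_trans o x y) _; join_le.
have [t [td _ _]] := T_rich [:: o] cutIF.
have [dot dto] := td o (or_introl erefl).
by exists t; rewrite dot dto vl_refl join0x.
Qed.

Lemma rich_above o s : exists t, vl_d o t = \bot /\ vl_d t o = s.
Proof.
have cutIF : is_cut (vl_d ^~ o) (fun y => vl_d o y `|` s).
  split=> x y; rewrite ?vl_joinE ?vl_meetE //; try exact: vl_trans.
  - by have := vl_trans x o y => h; rewrite joinAC leU2.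
  - join_le.
  - by apply: le_trans (vl_trans o x y) _; join_le.
have [t [td _ _]] := T_rich [:: o] cutIF.
have [dot dto] := td o (or_introl erefl).
by exists t; rewrite dot dto vl_refl join0x.
Qed.

(** The cut realizes the distance [s] met with [vl_d c a], whence the bound on [s]. *)
Lemma rich_between a c s : vl_d a c = \bot -> s <= vl_d c a ->
  exists t, [/\ vl_d a t = \bot, vl_d t c = \bot & vl_d c t = s].
Proof.
move=> ac sca.
have cutIF : is_cut (fun x => vl_d x c `|` (s `&` vl_d x a)) (vl_d c).
  have [Il Ij] := mixed_ideal a c s.
  split=> // x y; rewrite ?vl_meetE //; first exact: vl_trans.
  by apply: le_trans (vl_trans c x y) _; join_le.
have [t [td _ _]] := T_rich [:: a; c] cutIF.
have [dat dta] := td a (or_introl erefl).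
have [dct dtc] := td c (or_intror (or_introl erefl)).
exists t; rewrite dat dtc dct !vl_refl ac meetx0 !join0x; split=> //.
exact/meet_l.
Qed.

End Rich.

(** * The quotient lattice *)

Section Subvlat.
Variables (d : Order.disp_t) (S : bLatticeType d) (T : vlat S) (C : set T).
Variable z : T.
Hypothesis Cz : C z.
Hypothesis C_join : forall x y, C x -> C y -> C (vl_join x y).
Hypothesis C_meet : forall x y, C x -> C y -> C (vl_meet x y).

Definition sub_join (x y : {x | C x}) : {x | C x} :=
  exist _ _ (C_join (proj2_sig x) (proj2_sig y)).
Definition sub_meet (x y : {x | C x}) : {x | C x} :=
  exist _ _ (C_meet (proj2_sig x) (proj2_sig y)).

Lemma sub_refl (x : {x | C x}) : vl_d (sval x) (sval x) = \bot.
Proof. exact: vl_refl. Qed.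
Lemma sub_trans (y x w : {x | C x}) :
  vl_d (sval x) (sval w) <= vl_d (sval x) (sval y) `|` vl_d (sval y) (sval w).
Proof. exact: vl_trans. Qed.
Lemma sub_joinE (x y w : {x | C x}) : vl_d (sval (sub_join x y)) (sval w) =
  vl_d (sval x) (sval w) `|` vl_d (sval y) (sval w).
Proof. exact: vl_joinE. Qed.
Lemma sub_meetE (x y w : {x | C x}) : vl_d (sval w) (sval (sub_meet x y)) =
  vl_d (sval w) (sval x) `|` vl_d (sval w) (sval y).
Proof. exact: vl_meetE. Qed.

Definition sub_vlat : vlat S :=
  VLat (vl_d := fun x y => vl_d (sval x) (sval y)) (exist _ z Cz)
    sub_refl sub_trans sub_joinE sub_meetE.

End Subvlat.

Section Quotient.
Variables (d : Order.disp_t) (S : bLatticeType d) (U : vlat S).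
Implicit Types x y : U.

Definition canon x : U :=
  @xget {classic U} vl_pt [set y | vl_d x y = \bot /\ vl_d y x = \bot].

Lemma canonP x : vl_d x (canon x) = \bot /\ vl_d (canon x) x = \bot.
Proof.
rewrite /canon; case: xgetP => [y _ //|/(_ x)[]].
by rewrite /= vl_refl.
Qed.

(** Equivalent points have the same equivalence class, and [xget] chooses from the class alone. *)
Lemma canon_eq x y : vl_d x y = \bot -> vl_d y x = \bot -> canon x = canon y.
Proof.
move=> xy yx; rewrite /canon; congr (@xget {classic U} _ _); apply/seteqP.
by split=> w /=; rewrite (vl_equivl w xy yx) (vl_equivr w xy yx).
Qed.

Lemma canonK x : canon (canon x) = canon x.
Proof. by have [xc cx] := canonP x; apply: canon_eq. Qed.

Definition vquot := {x : U | canon x = x}.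
HB.instance Definition _ := gen_eqMixin vquot.
HB.instance Definition _ := gen_choiceMixin vquot.

Definition qpi x : vquot := exist _ (canon x) (canonK x).
Definition qd (a b : vquot) : S := vl_d (sval a) (sval b).

Lemma qd_pi x y : qd (qpi x) (qpi y) = vl_d x y.
Proof.
have [h h'] := canonP x; have [k k'] := canonP y.
by rewrite /qd /= (vl_equivl _ h' h) (vl_equivr _ k' k).
Qed.

Lemma qpiK (a : vquot) : qpi (sval a) = a.
Proof.
case: a => x xP; rewrite /qpi /=; move: (canonK x); rewrite xP => xP'.
by rewrite (Prop_irrelevance xP xP').
Qed.

Definition vquot_le (a b : vquot) : bool := qd a b == \bot.

Fact vquot_le_refl : reflexive vquot_le.
Proof. by move=> a; rewrite /vquot_le /qd vl_refl. Qed.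

Fact vquot_le_anti : antisymmetric vquot_le.
Proof.
move=> a b /andP[/eqP ab /eqP ba]; rewrite -(qpiK a) -(qpiK b).
have E := canon_eq ab ba; rewrite /qpi.
by move: (canonK (sval a)); rewrite E => e;
  rewrite (Prop_irrelevance e (canonK (sval b))).
Qed.

Fact vquot_le_trans : transitive vquot_le.
Proof.
move=> b a c /eqP ab /eqP bc; rewrite /vquot_le -lex0.
have := vl_trans (sval b) (sval a) (sval c).
by rewrite -!/(qd _ _) ab bc joinx0.
Qed.

Fact vquot_display : Order.disp_t. Proof. exact: Order.Disp tt tt. Qed.

HB.instance Definition _ :=
  Order.Le_isPOrder.Build vquot_display vquot
    vquot_le_refl vquot_le_anti vquot_le_trans.

Definition vquot_join (a b : vquot) : vquot := qpi (vl_join (sval a) (sval b)).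
Definition vquot_meet (a b : vquot) : vquot := qpi (vl_meet (sval a) (sval b)).

Lemma qd_join a b c : qd (vquot_join a b) c = qd a c `|` qd b c.
Proof. by rewrite -{1}(qpiK c) qd_pi vl_joinE. Qed.

Lemma qd_meet a b c : qd c (vquot_meet a b) = qd c a `|` qd c b.
Proof. by rewrite -{1}(qpiK c) qd_pi vl_meetE. Qed.

Fact vquot_leUx (a b c : vquot) : (vquot_join a b <= c) = (a <= c) && (b <= c).
Proof. by rewrite /Order.le /= /vquot_le qd_join -!lex0 leUx. Qed.

Fact vquot_lexI (c a b : vquot) : (c <= vquot_meet a b) = (c <= a) && (c <= b).
Proof. by rewrite /Order.le /= /vquot_le qd_meet -!lex0 leUx. Qed.

HB.instance Definition _ :=
  Order.POrder_isJoinSemilattice.Build _ vquot vquot_leUx.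
HB.instance Definition _ :=
  Order.POrder_isMeetSemilattice.Build _ vquot vquot_lexI.

End Quotient.

(** * Compact congruences of a valued lattice *)

Section PrincipalCongruences.
Variable P : partialLattice.
Implicit Types c : conc P.

Definition conc1 (x y : P) : conc P := Conc (compact_con_fin (finite_set1 (x, y))).

Lemma conc1_in x y : conc1 x y x y.
Proof. exact: con_gen_in. Qed.

Lemma conc_leP (a b : conc P) : (a <= b) <-> forall x y, a x y -> b x y.
Proof. by split=> [/con_leP|h]; [|apply/con_leP]. Qed.

Lemma conc1_le x y c : (conc1 x y <= c) <-> c x y.
Proof.
split=> [/conc_leP|cxy]; first by apply; exact: conc1_in.
by apply: con_gen_le => u v [-> ->].
Qed.

(** A compact congruence is generated by finitely many pairs, hence is a finite join of principal
    ones. *)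
Lemma conc_ind (Q : conc P -> Prop) : Q \bot ->
  (forall a b, Q a -> Q b -> Q (a `|` b)) -> (forall x y, Q (conc1 x y)) ->
  forall c, Q c.
Proof.
move=> Q0 QU Q1 c;
  have [A /finite_set_list[xs Axs] cA] := (compact_conP c).1 (@concP P c).
suff [c' [Qc' c'xs]] : exists c', Q c' /\
    conc_con c' = con_fin [set p : P * P | List.In p xs].
  suff -> : c = c' by [].
  apply: conc_inj; rewrite cA c'xs; congr con_fin.
  by apply/seteqP; split=> p /Axs.
elim: xs {A Axs cA} => [|[x y] xs [c' [Qc' c'xs]]].
  exists \bot; split=> //; apply/eqP; rewrite eq_le; apply/andP; split.
    by apply/con_leP => x y; apply: (conP (con_fin _)).1.
  by apply: con_gen_le => x y [].
exists (conc1 x y `|` c'); split; first exact: QU.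
apply/eqP; rewrite eq_le; apply/andP; split.
  apply: con_sup_lub => _ [->|->].
    by apply: con_gen_le => _ _ [-> ->]; apply: con_gen_in; left.
  by rewrite c'xs; apply: con_gen_le => u v uv; apply: con_gen_in; right.
apply: con_gen_le => u v [[<- <-]|uv].
  have : conc1 x y <= conc1 x y `|` c' by exact: leUl.
  by move=> /conc1_le.
have : c' <= conc1 x y `|` c' by exact: leUr.
by move=> /conc_leP; apply; rewrite c'xs; apply: con_gen_in.
Qed.

Variables (d : Order.disp_t) (S : bLatticeType d) (phi : conc P -> S).
Hypothesis phi_hom : semilattice0_hom phi.

Lemma conc_hom_mono a b : a <= b -> phi a <= phi b.
Proof. by move=> /join_r <-; rewrite phi_hom.1 leUl. Qed.

Lemma conc_hom_leP a s :
  (phi a <= s) <-> forall x y, a x y -> phi (conc1 x y) <= s.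
Proof.
split=> [h x y axy|]; first by apply: le_trans h; apply/conc_hom_mono/conc1_le.
elim/conc_ind: a => [_|a b IHa IHb h|x y]; first by rewrite phi_hom.2.
  rewrite phi_hom.1 leUx IHa ?IHb // => x y xy; apply: h.
    by have /conc_leP := leUr b a; apply.
  by have /conc_leP := leUl a b; apply.
by apply; exact: conc1_in.
Qed.

Definition phi_d (x y : P) : S := phi (conc1 x y).

Lemma phi_d_le0 x y : ple x y -> phi_d x y = \bot.
Proof.
move=> xy; rewrite /phi_d -phi_hom.2; congr phi; apply/eqP.
rewrite -lex0; apply/conc1_le; exact: xy.
Qed.

Lemma phi_d_refl x : phi_d x x = \bot.
Proof. exact/phi_d_le0/(ppl_refl (plat_prelattice P)). Qed.

Lemma phi_d_trans y x z : phi_d x z <= phi_d x y `|` phi_d y z.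
Proof.
rewrite /phi_d -phi_hom.1; apply/conc_hom_mono/conc1_le.
have [_ cP] := conP (conc1 x y `|` conc1 y z : conc P).
by apply: (ppl_trans cP); apply/conc1_le; [exact: leUl|exact: leUr].
Qed.

(** A declared join can be exploited only within one congruence containing all pairs at once.
    Finiteness is essential, since [phi] preserves finite joins. *)
Lemma phi_d_finsup (A : Type) (X : set A) (u v : A -> P) s : finite_set X ->
  (forall x, X x -> phi_d (u x) (v x) <= s) ->
  exists c : conc P, phi c <= s /\ forall x, X x -> c (u x) (v x).
Proof.
move=> /finite_set_list[xs Xxs] h.
suff [c [cs ch]] : exists c : conc P, phi c <= s /\
    forall x, List.In x xs -> c (u x) (v x).
  by exists c; split=> // x /Xxs; apply: ch.
have {h Xxs} : forall x, List.In x xs -> phi_d (u x) (v x) <= s.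
  by move=> x /Xxs; apply: h.
elim: xs => [_|x xs IH h]; first by exists \bot; rewrite phi_hom.2 le0x.
have [|c [cs ch]] := IH; first by move=> y yin; apply: h; right.
exists (conc1 (u x) (v x) `|` c); rewrite phi_hom.1 leUx cs andbT.
split; first by apply: h; left.
move=> y [<-|yin]; first by apply/conc1_le; exact: leUl.
by have /conc_leP := leUr c (conc1 (u x) (v x)); apply; apply: ch.
Qed.

Definition plat_join (X : set P) (a : P) : Prop := pjoin X = Some a.
Definition plat_meet (X : set P) (a : P) : Prop := pmeet X = Some a.

Lemma phi_d_join_ub X a x : plat_join X a -> X x -> phi_d x a = \bot.
Proof.
by move=> /(ppl_join_sup (plat_prelattice P))[ub _] /ub; exact: phi_d_le0.
Qed.

Lemma phi_d_meet_lb X a x : plat_meet X a -> X x -> phi_d a x = \bot.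
Proof.
by move=> /(ppl_meet_inf (plat_prelattice P))[ub _] /ub; exact: phi_d_le0.
Qed.

Lemma phi_d_join_lub X a b s : plat_join X a ->
  (forall x, X x -> phi_d x b <= s) -> phi_d a b <= s.
Proof.
move=> Xa h; have [finX _] := ppl_join_dom (plat_prelattice P) Xa.
have [c [cs ch]] := phi_d_finsup (u := id) (v := fun=> b) finX h.
apply: le_trans cs; apply/conc_hom_mono/conc1_le.
by have [_ cP] := conP c; have [_] := ppl_join_sup cP Xa; apply.
Qed.

Lemma phi_d_meet_glb X a b s : plat_meet X a ->
  (forall x, X x -> phi_d b x <= s) -> phi_d b a <= s.
Proof.
move=> Xa h; have [finX _] := ppl_meet_dom (plat_prelattice P) Xa.
have [c [cs ch]] := phi_d_finsup (u := fun=> b) (v := id) finX h.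
apply: le_trans cs; apply/conc_hom_mono/conc1_le.
by have [_ cP] := conP c; have [_] := ppl_meet_inf cP Xa; apply.
Qed.

Definition phi_vplat (p0 : P) : vplat S :=
  VPlat p0 phi_d_refl phi_d_trans phi_d_join_ub phi_d_join_lub
    phi_d_meet_lb phi_d_meet_glb.

End PrincipalCongruences.

(** * The isomorphism from the compact congruences onto [S] *)

Section ValuedLatticeCongruences.
Variables (d : Order.disp_t) (S : bLatticeType d).
Hypothesis S_ccB : conditionally_co_Brouwerian S.
Variables (dL : Order.disp_t) (L : latticeType dL) (L0 : inhabited L).
Variable D : L -> L -> S.
Hypothesis D_le : forall x y, (x <= y) = (D x y == \bot).
Hypothesis D_trans : forall y x z, D x z <= D x y `|` D y z.
Hypothesis D_join : forall x y z, D (x `|` y) z = D x z `|` D y z.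
Hypothesis D_meet : forall x y z, D z (x `&` y) = D z x `|` D z y.
Hypothesis L_compl : relatively_complemented L.
Hypothesis L_M3 : forall a b c, a <= b -> b <= c -> D c a <= D b a ->
  exists p q, [/\ a <= p, a <= q, c <= b `|` p, c <= b `|` q & p `&` q <= a].
Hypothesis D_onto : forall s, exists x y, D x y = s.

Notation PL := (plat_of_lattice L0).

Lemma pjoin2 (x y : L) : pjoin (p := PL) [set x; y] = Some (x `|` y).
Proof.
apply/lattice_pjoinE; split; [exact: finite_set2|by exists x; left|].
split=> [z [] ->|b h]; rewrite /lattice_le ?leUl ?leUr //.
by rewrite leUx (h x (or_introl erefl)) (h y (or_intror erefl)).
Qed.

Lemma pmeet2 (x y : L) : pmeet (p := PL) [set x; y] = Some (x `&` y).
Proof.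
apply/lattice_pmeetE; split; [exact: finite_set2|by exists x; left|].
split=> [z [] ->|b h]; rewrite /lattice_le ?leIl ?leIr //.
by rewrite lexI (h x (or_introl erefl)) (h y (or_intror erefl)).
Qed.

Lemma con_le_incl (c : con PL) (x y : L) : x <= y -> c x y.
Proof. by move=> xy; apply: (conP c).1. Qed.

Lemma con_transl (c : con PL) (y x z : L) : c x y -> c y z -> c x z.
Proof. by have [_ cP] := conP c; apply: (ppl_trans cP). Qed.

Lemma con_joinU (c : con PL) (x y z : L) : c x z -> c y z -> c (x `|` y) z.
Proof.
move=> xz yz; have [_ cP] := conP c.
by have [_] := ppl_join_sup cP (pjoin2 x y); apply => _ [->|->].
Qed.

Lemma con_meetI (c : con PL) (x y z : L) : c z x -> c z y -> c z (x `&` y).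
Proof.
move=> xz yz; have [_ cP] := conP c.
by have [_] := ppl_meet_inf cP (pmeet2 x y); apply => _ [->|->].
Qed.

Lemma D_le0 x y : x <= y -> D x y = \bot.
Proof. by rewrite D_le => /eqP. Qed.

Lemma D_monol x x' y : x <= x' -> D x y <= D x' y.
Proof. by move=> h; apply: le_trans (D_trans x' _ _) _; rewrite D_le0 ?join0x. Qed.

Lemma D_monor x y y' : y <= y' -> D x y' <= D x y.
Proof. by move=> h; apply: le_trans (D_trans y _ _) _; rewrite (D_le0 h) joinx0. Qed.

Fact dcon_subproof s : is_congruence (P := PL) (fun x y => D x y <= s).
Proof.
split=> [x y xy|]; first by rewrite D_le0.
split=> //.
- by move=> x; rewrite D_le0.
- by move=> x y z xy yz; apply: le_trans (D_trans y _ _) _; rewrite leUx xy.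
- by move=> X a /lattice_pjoinE[].
- by move=> X a /lattice_pmeetE[].
- move=> X a /lattice_pjoinE[finX X0 [ub lub]]; split=> [x /ub xa|b h].
    by rewrite D_le0.
  have [xs Xxs] := (finite_set_list finX).
  (* The supremum [a] lies below any upper bound [e] of the list; the iterated join starts at [b],
     which is at distance [\bot] from itself. *)
  have : exists e, (forall x, List.In x xs -> x <= e) /\ D e b <= s.
    have : forall x, List.In x xs -> D x b <= s by move=> x /Xxs; apply: h.
    elim: xs {Xxs} => [_|x xs IH hs]; first by exists b; rewrite D_le0.
    have [|e [he eb]] := IH; first by move=> y yin; apply: hs; right.
    exists (x `|` e); rewrite D_join leUx eb hs; last by left.
    by split=> // y [<-|/he ye]; rewrite lexU2 ?lexx ?ye ?orbT.
  move=> [e [he eb]]; apply: le_trans eb; apply: D_monol.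
  by apply: lub => x /Xxs/he.
- move=> X a /lattice_pmeetE[finX X0 [ub lub]]; split=> [x /ub xa|b h].
    by rewrite D_le0.
  have [xs Xxs] := (finite_set_list finX).
  have : exists e, (forall x, List.In x xs -> e <= x) /\ D b e <= s.
    have : forall x, List.In x xs -> D b x <= s by move=> x /Xxs; apply: h.
    elim: xs {Xxs} => [_|x xs IH hs]; first by exists b; rewrite D_le0.
    have [|e [he eb]] := IH; first by move=> y yin; apply: hs; right.
    exists (x `&` e); rewrite D_meet leUx eb hs; last by left.
    by split=> // y [<-|/he ye]; rewrite leIx2 ?lexx ?ye ?orbT.
  move=> [e [he eb]]; apply: le_trans eb; apply: D_monor.
  by apply: lub => x /Xxs/he.
Qed.

Definition dcon s : con PL := Con (dcon_subproof s).

Definition psi (c : conc PL) : S :=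
  binf [set s | forall x y, c x y -> D x y <= s].

(** Compactness enters here: finitely many generators bound the values of all pairs of [c], so the
    infimum defining [psi] is over a nonempty set. *)
Lemma psi_leP c s : (psi c <= s) <-> forall x y, c x y -> D x y <= s.
Proof.
split=> [h x y cxy|h]; last exact: (binf_lb S_ccB).
apply: le_trans h; apply: (binf_glb0 S_ccB) => [|r]; last exact.
suff [r hr] : exists r, (c : con PL) <= dcon r.
  by exists r => u v; move/con_leP: hr; apply.
elim/conc_ind: c {x y cxy} => [|a b [r hr] [r' hr']|x y].
- by exists \bot; apply/con_leP => x y xy /=; rewrite D_le0.
- exists (r `|` r'); apply: con_sup_lub => _ [->|->].
    by apply: le_trans hr _; apply/con_leP => x y /= h; rewrite lexU2 ?h.
  by apply: le_trans hr' _; apply/con_leP => x y /= h; rewrite lexU2 ?h ?orbT.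
- by exists (D x y); apply: con_gen_le => _ _ [-> ->] /=.
Qed.

Lemma psi_dcon c s : (psi c <= s) <-> (c : con PL) <= dcon s.
Proof.
by split=> [/psi_leP h|/con_leP h]; [apply/con_leP|apply/psi_leP].
Qed.

Lemma psi_conc1 (x y : L) : psi (conc1 (P := PL) x y) = D x y.
Proof.
apply: eq_from_le => s; apply/idP/idP => [/psi_leP|h].
  by apply; exact: (conc1_in (P := PL)).
by apply/psi_dcon; apply: con_gen_le => _ _ [-> ->].
Qed.

Lemma psi_hom : semilattice0_hom psi.
Proof.
split=> [a b|]; last first.
  by apply/eqP; rewrite -lex0; apply/psi_leP => x y /= xy; rewrite D_le0.
apply: eq_from_le => s; rewrite leUx; apply/idP/andP.
  move=> /psi_dcon h; split; apply/psi_dcon; apply: le_trans h.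
    exact: (leUl a b).
  exact: (leUr b a).
move=> [/psi_dcon h /psi_dcon h']; apply/psi_dcon.
by apply: con_sup_lub => _ [->|->].
Qed.

(* A relative complement moves the quotient [b/a] down to [w/a']. *)
Lemma push_down (c : con PL) (a a' b : L) : a' <= a -> a <= b -> c b a ->
  exists w, [/\ a' <= w, c w a' & D b a <= D w a'].
Proof.
move=> a'a ab cba; have [w [aw awb]] := L_compl a'a ab.
have wb : w <= b by rewrite -awb leUr.
exists w; split.
- by rewrite -aw leIr.
- rewrite -aw; apply: con_meetI; last exact: con_le_incl.
  by apply: con_transl cba; apply: con_le_incl.
- rewrite -{1}awb D_join (D_le0 (lexx a)) join0x.
  exact: D_monor.
Qed.

(** One interval carries the whole value of [c]. For a join, the second interval is placed with its
    bottom below the first, the first is pushed down to that bottom, and the tops are joined. *)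
Lemma conc_interval (c : conc PL) (a0 : L) : exists a w,
  [/\ a <= a0, a <= w, c w a & psi c <= D w a].
Proof.
elim/conc_ind: c a0 => [|b b' IHb IHb'|u v] a0.
- exists a0, a0; split=> //; first exact: con_le_incl.
  by rewrite psi_hom.2.
- have [a [w [aa0 aw cwa ha]]] := IHb a0.
  have [a' [w' [aa' aw' cwa' ha']]] := IHb' a.
  have [w1 [aw1 cw1 Dw1]] := push_down aa' aw cwa.
  exists a', (w1 `|` w'); split.
  + exact: le_trans aa0.
  + by rewrite lexU2 ?aw1.
  + apply: con_joinU.
      by have /conc_leP := leUl b b'; apply.
    by have /conc_leP := leUr b' b; apply.
  + rewrite psi_hom.1 D_join leU2 //; exact: le_trans ha Dw1.
- have uv : conc1 (P := PL) u v (u `|` v) v.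
    by apply: con_joinU; [exact: (conc1_in (P := PL))|exact: con_le_incl].
  have [w [aw cw Dw]] := push_down (leIr v a0) (leUr v u) uv.
  exists (a0 `&` v), w; split=> //; first exact: leIl.
  rewrite psi_conc1; apply: le_trans Dw; apply: D_monol; exact: leUl.
Qed.

(** An interval from [a] to [w] collapsed by [c'] is at least as long as the pair [x], [y]. The pair
    is moved to an interval from [a] to [z], and [L_M3] transfers the collapse from [w] to [z]. *)
Lemma psi_le_inv c c' : psi c <= psi c' -> c <= c'.
Proof.
move=> cc'; apply/conc_leP => x y cxy.
have [a [w [ay aw cwa pa]]] := conc_interval c' y.
have Dxy : D x y <= D w a.
  by apply: le_trans pa; apply: le_trans cc'; apply: (psi_leP c _).1 cxy.
have [z [yz yzx]] := L_compl ay (leUr y x).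
have az : a <= z by rewrite -yz leIr.
have Dza : D z a <= D w a.
  apply: le_trans Dxy; rewrite -yz D_meet (D_le0 (lexx z)) joinx0.
  rewrite -[D x y]joinx0 -(D_le0 (lexx y)) -D_join; apply: D_monol.
  by rewrite -yzx leUr.
have [|p [q [ap aq wp wq pq]]] := L_M3 aw (leUl w z).
  by rewrite D_join leUx lexx.
(* Modulo [c'] the element [w] drops to [a], so [w] joined with [z] falls below both [p] and [q],
   hence below their meet and [a]. *)
have ca u : a <= u -> w `|` z <= w `|` u -> c' (w `|` z) u.
  move=> au h; apply: (con_transl (y := w `|` u)); first exact: con_le_incl.
  apply: con_joinU; last exact: con_le_incl.
  by apply: con_transl cwa _; apply: con_le_incl.
have cza : c' z a.
  apply: (con_transl (y := w `|` z)); first by apply: con_le_incl; exact: leUr.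
  apply: (con_transl (y := p `&` q)); last exact: con_le_incl.
  by apply: con_meetI; apply: ca.
apply: (con_transl (y := y `|` z)).
  by apply: con_le_incl; rewrite yzx leUl.
apply: con_joinU; first exact: con_le_incl.
by apply: con_transl cza _; apply: con_le_incl.
Qed.

Lemma psi_bij : bijective psi.
Proof.
have psi_inj : injective psi.
  by move=> c c' E; apply/eqP; rewrite eq_le; apply/andP; split;
    apply: psi_le_inv; rewrite E.
have [g gP] : {g : S -> conc PL & forall s, psi (g s) = s}.
  apply: (choice (P := fun s c => psi c = s)) => s.
  by have [x [y xy]] := D_onto s; exists (conc1 (P := PL) x y); rewrite psi_conc1.
by exists g => // c; apply: psi_inj; rewrite gP.
Qed.

End ValuedLatticeCongruences.

(** * The amalgamation of a family *)

Section FiniteJoinsInLimit.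
Variables (d : Order.disp_t) (S : bLatticeType d).
Hypothesis S_ccB : conditionally_co_Brouwerian S.
Variables (T : vlat S) (A : Type) (X : set A) (u : A -> T).
Hypothesis finX : finite_set X.
Hypothesis X0 : X !=set0.
Notation inj x := (lim_in (S_ccB := S_ccB) (T := T) (n := 0) x : limit S_ccB T).

(** Declared joins are known to be joins only against ideals of the first level. An iterated binary
    join of [T] keeps its universal property up the whole tower and serves as intermediary. *)
Lemma limit_finite_join : exists j : T,
  (forall x, X x -> vl_d (u x) j = \bot) /\
  forall (z : limit S_ccB T) s, (forall x, X x -> vl_d (inj (u x)) z <= s) ->
    vl_d (inj j) z <= s.
Proof.
have [[|x0 xs] Xxs] := finite_set_list finX.
  by case: X0 => x /Xxs.
suff [j [ju jl]] : exists j : T,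
    (forall x, List.In x (x0 :: xs) -> vl_d (u x) j = \bot) /\
    forall (z : limit S_ccB T) s,
      (forall x, List.In x (x0 :: xs) -> vl_d (inj (u x)) z <= s) ->
      vl_d (inj j) z <= s.
  exists j; split=> [x /Xxs/ju //|z s h].
  by apply: jl => x /Xxs/h.
elim: xs x0 {Xxs} => [|x1 xs IH] x0.
  exists (u x0); split=> [x [<-|[]]|z s h]; first exact: vl_refl.
  by apply: h; left.
have [j [ju jl]] := IH x1; exists (vl_join (u x0) j); split.
  have [h h'] := vl_join_ub (u x0) j.
  move=> x [<-|/ju xj]; first exact: h.
  by apply/eqP; rewrite -lex0 (le_trans (vl_trans j _ _)) // xj h' joinx0.
move=> z s h; rewrite [X in X <= _](lim_in_join (S_ccB := S_ccB)) leUx.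
apply/andP; split.
  by apply: h; left.
by apply: jl => x xin; apply: h; right.
Qed.

Lemma limit_finite_meet : exists j : T,
  (forall x, X x -> vl_d j (u x) = \bot) /\
  forall (z : limit S_ccB T) s, (forall x, X x -> vl_d z (inj (u x)) <= s) ->
    vl_d z (inj j) <= s.
Proof.
have [[|x0 xs] Xxs] := finite_set_list finX.
  by case: X0 => x /Xxs.
suff [j [ju jl]] : exists j : T,
    (forall x, List.In x (x0 :: xs) -> vl_d j (u x) = \bot) /\
    forall (z : limit S_ccB T) s,
      (forall x, List.In x (x0 :: xs) -> vl_d z (inj (u x)) <= s) ->
      vl_d z (inj j) <= s.
  exists j; split=> [x /Xxs/ju //|z s h].
  by apply: jl => x /Xxs/h.
elim: xs x0 {Xxs} => [|x1 xs IH] x0.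
  exists (u x0); split=> [x [<-|[]]|z s h]; first exact: vl_refl.
  by apply: h; left.
have [j [ju jl]] := IH x1; exists (vl_meet (u x0) j); split.
  have [h h'] := vl_meet_lb (u x0) j.
  move=> x [<-|/ju xj]; first exact: h.
  by apply/eqP; rewrite -lex0 (le_trans (vl_trans j _ _)) // xj h' joinx0.
move=> z s h; rewrite [X in X <= _](lim_in_meet (S_ccB := S_ccB)) leUx.
apply/andP; split.
  by apply: h; left.
by apply: jl => x xin; apply: h; right.
Qed.

End FiniteJoinsInLimit.

Section ConcMapPsi.

Lemma conc_map1 (P Q : partialLattice) (f : platHom P Q) x y :
  conc_map f (conc1 x y) = conc1 (f x) (f y).
Proof.
apply: conc_inj; apply/eqP; rewrite eq_le; apply/andP; split.
  apply: con_gen_le => _ _ [u [v [uv -> ->]]].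
  pose c := Con (con_preim_subproof f (conc1 (f x) (f y))).
  have /con_leP : (conc1 x y : con P) <= c.
    by apply: con_gen_le => _ _ [-> ->]; exact: conc1_in.
  by apply.
apply: con_gen_le => _ _ [-> ->]; apply: con_gen_in; exists x, y; split=> //.
exact: conc1_in.
Qed.

Variables (d : Order.disp_t) (S : bLatticeType d).
Hypothesis S_ccB : conditionally_co_Brouwerian S.
Variables (dL : Order.disp_t) (L : latticeType dL) (L0 : inhabited L).
Variable D : L -> L -> S.
Hypothesis D_le : forall x y, (x <= y) = (D x y == \bot).
Hypothesis D_trans : forall y x z, D x z <= D x y `|` D y z.
Hypothesis D_join : forall x y z, D (x `|` y) z = D x z `|` D y z.
Hypothesis D_meet : forall x y z, D z (x `&` y) = D z x `|` D z y.
Variables (P : partialLattice) (phi : conc P -> S).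
Hypothesis phi_hom : semilattice0_hom phi.
Variable g : platHom P (plat_of_lattice L0).
Hypothesis D_g : forall x y, D (g x) (g y) = phi (conc1 x y).

Lemma psi_conc_map : phi =1 psi D \o conc_map g.
Proof.
move=> a; apply: eq_from_le => s; apply/idP/idP => /=.
  move=> /(conc_hom_leP phi_hom) h.
  apply/(psi_dcon S_ccB D_le D_trans D_join D_meet).
  by apply: con_gen_le => _ _ [x [y [axy -> ->]]] /=; rewrite D_g h.
move=> /(psi_leP S_ccB D_le D_trans D_join D_meet) h.
apply/(conc_hom_leP phi_hom) => x y axy; rewrite -D_g; apply: h.
by apply: con_gen_in; exists x, y.
Qed.

End ConcMapPsi.

(** * A family of partial lattices over a common lattice *)

Section FamilyAmalgamation.
Variables (d0 : Order.disp_t) (P0 : latticeType d0) (P0ne : inhabited P0).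
Variables (K : eqType) (k0 : K) (P : K -> partialLattice).
Variable f : forall k, platHom (plat_of_lattice P0ne) (P k).
Variables (dS : Order.disp_t) (S : bLatticeType dS).
Hypothesis S_ccB : conditionally_co_Brouwerian S.
Variable phi : forall k, conc (P k) -> S.
Hypothesis phi_hom : forall k, semilattice0_hom (@phi k).
Hypothesis phi_f : forall k l c,
  phi (conc_map (f k) c) = phi (conc_map (f l) c).
Variable z0 : P0.

Definition fam_vplat k : vplat S := phi_vplat (phi_hom k) (f k z0).
Definition fam_base k (z : P0) : fam_vplat k := f k z.

Lemma fam_baseE k l x y :
  vp_d (fam_base k x) (fam_base k y) = vp_d (fam_base l x) (fam_base l y).
Proof. by rewrite /= /phi_d -!conc_map1 (phi_f k l). Qed.

Lemma fam_base_join k x y w : vp_d (fam_base k (x `|` y)) w =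
  vp_d (fam_base k x) w `|` vp_d (fam_base k y) w.
Proof.
have := plat_hom_join (f k) (pjoin2 P0ne x y).
rewrite image_setU !image_set1 => xy; apply/eqP; rewrite eq_le leUx.
apply/andP; split.
  apply: (vp_join_lub (v := fam_vplat k) xy) => _ [->|->]; [exact: leUl|exact: leUr].
by apply/andP; split; apply: le_trans (vp_trans (fam_base k (x `|` y)) _ _) _;
  rewrite leUx lexx andbT (vp_join_ub (v := fam_vplat k) xy) //; [left|right].
Qed.

Lemma fam_base_meet k x y w : vp_d w (fam_base k (x `&` y)) =
  vp_d w (fam_base k x) `|` vp_d w (fam_base k y).
Proof.
have := plat_hom_meet (f k) (pmeet2 P0ne x y).
rewrite image_setU !image_set1 => xy; apply/eqP; rewrite eq_le leUx.
apply/andP; split.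
  apply: (vp_meet_glb (v := fam_vplat k) xy) => _ [->|->]; [exact: leUl|exact: leUr].
by apply/andP; split; apply: le_trans (vp_trans (fam_base k (x `&` y)) _ _) _;
  rewrite leUx lexx andTb (vp_meet_lb (v := fam_vplat k) xy) //; [left|right].
Qed.

(** By [fam_baseE], every index gives the same distance on [P0]. *)
Definition base_d (x y : P0) : S := vp_d (fam_base k0 x) (fam_base k0 y).

Definition base_vlat : vlat S := VLat (vl_d := base_d) z0
  (fun x => vp_refl (fam_base k0 x))
  (fun y x z => vp_trans (fam_base k0 y) (fam_base k0 x) (fam_base k0 z))
  (fun x y z => @fam_base_join k0 x y (fam_base k0 z))
  (fun x y z => @fam_base_meet k0 x y (fam_base k0 z)).

Definition fam_amalgam : vplat S.
Proof.
apply: (@amalgam _ _ S_ccB base_vlat K k0 fam_vplat fam_base).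
- by move=> k x y; exact: fam_baseE.
- by move=> k x y w; rewrite -fam_base_join.
- by move=> k x y w; rewrite -fam_base_meet.
- by move=> k X a Xa; apply: ppl_join_dom (plat_prelattice (P k)) _ _ Xa.
- by move=> k X a Xa; apply: ppl_meet_dom (plat_prelattice (P k)) _ _ Xa.
Defined.

Definition ambient0 : vlat S := ideal_vlat S_ccB fam_amalgam.
Definition ambient : vlat S := limit S_ccB ambient0.

Definition emb0 k (x : P k) : ambient0 :=
  pideal (W := fam_amalgam) (existT (fun k => vp_sort (fam_vplat k)) k x).
Definition emb k (x : P k) : ambient :=
  lim_in (S_ccB := S_ccB) (T := ambient0) (n := 0) (emb0 x).

Lemma emb_d k (x y : P k) : vl_d (emb x) (emb y) = phi (conc1 x y).
Proof.
rewrite [LHS]lim_in_d [LHS](pidealE S_ccB).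
exact: (amalgam_dE S_ccB).
Qed.

Lemma emb_f k l z : vl_d (emb (f k z)) (emb (f l z)) = \bot.
Proof.
rewrite [LHS]lim_in_d [LHS](pidealE S_ccB).
exact: (amalgam_base S_ccB).
Qed.

Lemma emb_join k (X : set (P k)) a (z : ambient) s : pjoin X = Some a ->
  (forall x, X x -> vl_d (emb x) z <= s) -> vl_d (emb a) z <= s.
Proof.
move=> Xa h; have [finX X0] := ppl_join_dom (plat_prelattice (P k)) Xa.
have [j [ju jl]] := limit_finite_join S_ccB (@emb0 k) finX X0.
pose j' : ambient := lim_in (S_ccB := S_ccB) (T := ambient0) (n := 0) j.
(* The image of [a] is below [j'] by the ideal property at the first level, and [j'] is below [z] up
   to [s] in the limit. *)
apply: le_trans (vl_trans j' _ _) _.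
rewrite leUx jl // andbT [X in X <= _]lim_in_d; apply: le_trans (le0x s).
apply: (pideal_join_lub S_ccB (W := fam_amalgam)
  (X := [set existT (fun k => vp_sort (fam_vplat k)) k x | x in X])).
  by exists k, X, a.
by move=> _ [x Xx <-]; rewrite [X in X <= _](ju x Xx).
Qed.

Lemma emb_meet k (X : set (P k)) a (z : ambient) s : pmeet X = Some a ->
  (forall x, X x -> vl_d z (emb x) <= s) -> vl_d z (emb a) <= s.
Proof.
move=> Xa h; have [finX X0] := ppl_meet_dom (plat_prelattice (P k)) Xa.
have [j [ju jl]] := limit_finite_meet S_ccB (@emb0 k) finX X0.
pose j' : ambient := lim_in (S_ccB := S_ccB) (T := ambient0) (n := 0) j.
apply: le_trans (vl_trans j' _ _) _.
rewrite leUx jl //= [X in X <= _]lim_in_d; apply: le_trans (le0x s).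
apply: (pideal_meet_glb S_ccB (W := fam_amalgam)
  (X := [set existT (fun k => vp_sort (fam_vplat k)) k x | x in X])).
  by exists k, X, a.
by move=> _ [x Xx <-]; rewrite [X in X <= _](ju x Xx).
Qed.

(** * The lattice obtained from a convex part of the ambient structure *)

Section Convex.
Variable C : set ambient.
Hypothesis C_emb : forall k (x : P k), C (emb x).
Hypothesis C_join : forall x y, C x -> C y -> C (vl_join x y).
Hypothesis C_meet : forall x y, C x -> C y -> C (vl_meet x y).
Hypothesis C_convex : forall x y z, C x -> C z ->
  vl_d x y = \bot -> vl_d y z = \bot -> C y.
Hypothesis C_onto : forall s, exists x y, [/\ C x, C y & vl_d x y = s].

Definition cvx : vlat S := sub_vlat (C_emb (f k0 z0)) C_join C_meet.
Definition cvx_lat := vquot cvx.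
Definition cvx_pi (x : ambient) (Cx : C x) : cvx_lat := qpi (exist _ x Cx : cvx).

Lemma cvx_pi_surj (a : cvx_lat) : exists x (Cx : C x), a = cvx_pi Cx.
Proof.
exists (sval (sval a)), (proj2_sig (sval a)); rewrite /cvx_pi -[LHS]qpiK.
by congr qpi; case: (sval a).
Qed.

Lemma cvx_pi_d x y (Cx : C x) (Cy : C y) :
  qd (cvx_pi Cx) (cvx_pi Cy) = vl_d x y.
Proof. exact: qd_pi. Qed.

Lemma cvx_pi_le x y (Cx : C x) (Cy : C y) :
  (cvx_pi Cx <= cvx_pi Cy) = (vl_d x y == \bot).
Proof. by rewrite -(cvx_pi_d Cx Cy). Qed.

Lemma cvx_pi_join x y (Cx : C x) (Cy : C y) :
  cvx_pi Cx `|` cvx_pi Cy = cvx_pi (C_join Cx Cy).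
Proof.
have [w [Cw E]] := cvx_pi_surj (cvx_pi Cx `|` cvx_pi Cy).
have [xj yj] := vl_join_ub x y.
apply/eqP; rewrite eq_le; apply/andP; split.
  by rewrite leUx !cvx_pi_le xj yj eqxx.
rewrite E cvx_pi_le vl_joinE -lex0 leUx !lex0 -(cvx_pi_le Cx Cw) -(cvx_pi_le Cy Cw) -E.
by rewrite leUl leUr.
Qed.

Lemma cvx_pi_meet x y (Cx : C x) (Cy : C y) :
  cvx_pi Cx `&` cvx_pi Cy = cvx_pi (C_meet Cx Cy).
Proof.
have [w [Cw E]] := cvx_pi_surj (cvx_pi Cx `&` cvx_pi Cy).
have [xj yj] := vl_meet_lb x y.
apply/eqP; rewrite eq_le; apply/andP; split; last first.
  by rewrite lexI !cvx_pi_le xj yj eqxx.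
rewrite E cvx_pi_le vl_meetE -lex0 leUx !lex0 -(cvx_pi_le Cw Cx) -(cvx_pi_le Cw Cy) -E.
by rewrite leIl leIr.
Qed.

Lemma cvx_inh : inhabited cvx_lat.
Proof. exact: (inhabits (cvx_pi (C_emb (f k0 z0)))). Qed.

Definition cvx_g_fun k (x : P k) : cvx_lat := cvx_pi (C_emb x).

Lemma cvx_g_le k (x y : P k) : ple x y ->
  lattice_le (cvx_g_fun x) (cvx_g_fun y).
Proof.
move=> xy; rewrite /lattice_le cvx_pi_le emb_d; apply/eqP.
exact: (phi_d_le0 (phi_hom k) xy).
Qed.

Lemma cvx_g_join k (X : set (P k)) a : pjoin X = Some a ->
  lattice_pjoin (@cvx_g_fun k @` X) = Some (cvx_g_fun a).
Proof.
move=> Xa; have [finX [x0 Xx0]] := ppl_join_dom (plat_prelattice (P k)) Xa.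
apply/lattice_pjoinE; split; [exact: finite_image|by exists (cvx_g_fun x0), x0|].
split=> [_ [x Xx <-]|b h].
  by apply: cvx_g_le; apply: (ppl_join_sup (plat_prelattice (P k)) Xa).1.
have [y [Cy yb]] := cvx_pi_surj b; subst b.
rewrite /lattice_le cvx_pi_le -lex0; apply: emb_join Xa _ => x Xx.
have := h (cvx_g_fun x); rewrite /lattice_le cvx_pi_le -lex0; apply.
by exists x.
Qed.

Lemma cvx_g_meet k (X : set (P k)) a : pmeet X = Some a ->
  lattice_pmeet (@cvx_g_fun k @` X) = Some (cvx_g_fun a).
Proof.
move=> Xa; have [finX [x0 Xx0]] := ppl_meet_dom (plat_prelattice (P k)) Xa.
apply/lattice_pmeetE; split; [exact: finite_image|by exists (cvx_g_fun x0), x0|].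
split=> [_ [x Xx <-]|b h].
  by apply: cvx_g_le; apply: (ppl_meet_inf (plat_prelattice (P k)) Xa).1.
have [y [Cy yb]] := cvx_pi_surj b; subst b.
rewrite /lattice_le cvx_pi_le -lex0; apply: emb_meet Xa _ => x Xx.
have := h (cvx_g_fun x); rewrite /lattice_le cvx_pi_le -lex0; apply.
by exists x.
Qed.

Definition cvx_g k : platHom (P k) (plat_of_lattice cvx_inh) :=
  PlatHom (Q := plat_of_lattice cvx_inh)
    (@cvx_g_le k) (@cvx_g_join k) (@cvx_g_meet k).

Lemma cvx_g_d k (x y : P k) : qd (cvx_g k x) (cvx_g k y) = phi (conc1 x y).
Proof. by rewrite [LHS]cvx_pi_d emb_d. Qed.

Lemma cvx_g_f k l z : cvx_g k (f k z) = cvx_g l (f l z).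
Proof.
by apply/eqP; rewrite eq_le [X in X && _]cvx_pi_le [X in _ && X]cvx_pi_le !emb_f eqxx.
Qed.

Lemma ambient_rich : rich ambient. Proof. exact: limit_rich. Qed.

Lemma cvx_compl : relatively_complemented cvx_lat.
Proof.
move=> a c b; have [x [Cx ->]] := cvx_pi_surj a; have [y [Cy ->]] := cvx_pi_surj b.
have [z [Cz ->]] := cvx_pi_surj c; rewrite !cvx_pi_le => /eqP xy /eqP yz.
have [t [xt tz ytx zyt]] := rich_complement S_ccB ambient_rich xy yz.
have Ct : C t by apply: C_convex Cx Cz xt tz.
exists (cvx_pi Ct); rewrite cvx_pi_join cvx_pi_meet.
split; apply/eqP; rewrite eq_le !cvx_pi_le ?ytx ?zyt ?eqxx ?andbT ?andTb.
  by rewrite vl_meetE xy xt joinx0.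
by rewrite vl_joinE yz tz joinx0.
Qed.

Lemma cvx_M3 (a b c : cvx_lat) : a <= b -> b <= c -> qd c a <= qd b a ->
  exists p q, [/\ a <= p, a <= q, c <= b `|` p, c <= b `|` q & p `&` q <= a].
Proof.
have [x [Cx ->]] := cvx_pi_surj a; have [y [Cy ->]] := cvx_pi_surj b.
have [z [Cz ->]] := cvx_pi_surj c; rewrite !cvx_pi_le !cvx_pi_d.
move=> /eqP xy /eqP yz zx.
have [p [q [[xp pz] [xq qz] yp yq pq]]] := rich_M3 ambient_rich xy yz zx.
have Cp : C p by apply: C_convex Cx Cz xp pz.
have Cq : C q by apply: C_convex Cx Cz xq qz.
exists (cvx_pi Cp), (cvx_pi Cq); rewrite !cvx_pi_join cvx_pi_meet !cvx_pi_le.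
by rewrite xp xq yp yq pq !eqxx.
Qed.

Lemma cvx_onto s : exists a b : cvx_lat, qd a b = s.
Proof.
have [x [y [Cx Cy <-]]] := C_onto s.
by exists (cvx_pi Cx), (cvx_pi Cy); rewrite cvx_pi_d.
Qed.

Definition cvx_psi : conc (plat_of_lattice cvx_inh) -> S :=
  psi (@qd _ _ cvx).

Lemma qd_le (a b : cvx_lat) : (a <= b) = (qd a b == \bot).
Proof. by []. Qed.

Lemma qd_trans (b a c : cvx_lat) : qd a c <= qd a b `|` qd b c.
Proof. exact: vl_trans. Qed.

Lemma cvx_psi_hom : semilattice0_hom cvx_psi.
Proof.
exact: (psi_hom S_ccB cvx_inh qd_le qd_trans (@qd_join _ _ _) (@qd_meet _ _ _)).
Qed.

Lemma cvx_psi_bij : bijective cvx_psi.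
Proof.
exact: (psi_bij S_ccB cvx_inh qd_le qd_trans (@qd_join _ _ _) (@qd_meet _ _ _)
  cvx_compl cvx_M3 cvx_onto).
Qed.

Lemma cvx_psi_g k : @phi k =1 cvx_psi \o conc_map (cvx_g k).
Proof.
exact: (psi_conc_map S_ccB qd_le qd_trans (@qd_join _ _ _) (@qd_meet _ _ _)
  (phi_hom k) (@cvx_g_d k)).
Qed.

Definition pullback (D : set cvx_lat) : set ambient :=
  [set x | exists Cx : C x, D (cvx_pi Cx)].

Lemma pullbackT (D : set cvx_lat) : C `<=` pullback D -> forall a, D a.
Proof.
move=> CD a; have [x [Cx ->]] := cvx_pi_surj a.
by have [Cx' h] := CD x Cx; rewrite (Prop_irrelevance Cx Cx').
Qed.

End Convex.

(** * Generated ideals, filters and convex parts *)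

Definition emb_range : set ambient := [set x | exists k (y : P k), x = emb y].

Definition amb_ideal (I : set ambient) : Prop :=
  (forall x y, vl_d x y = \bot -> I y -> I x) /\
  (forall x y, I x -> I y -> I (vl_join x y)).

Definition amb_filter (I : set ambient) : Prop :=
  (forall x y, vl_d x y = \bot -> I x -> I y) /\
  (forall x y, I x -> I y -> I (vl_meet x y)).

Definition amb_convex (C : set ambient) : Prop :=
  [/\ forall x y, C x -> C y -> C (vl_join x y),
      forall x y, C x -> C y -> C (vl_meet x y)
    & forall x y z, C x -> C z -> vl_d x y = \bot -> vl_d y z = \bot -> C y].

Definition hull (Pr : set ambient -> Prop) : set ambient :=
  [set x | forall I, Pr I -> emb_range `<=` I -> I x].

Lemma hull_emb Pr k (x : P k) : hull Pr (emb x).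
Proof. by move=> I _; apply; exists k, x. Qed.

Lemma hull_ideal : amb_ideal (hull amb_ideal).
Proof.
split=> [x y xy hy I II RI|x y hx hy I II RI].
  by apply: II.1 xy (hy I II RI).
by apply: II.2; [exact: hx|exact: hy].
Qed.

Lemma hull_filter : amb_filter (hull amb_filter).
Proof.
split=> [x y xy hy I II RI|x y hx hy I II RI].
  by apply: II.1 xy (hy I II RI).
by apply: II.2; [exact: hx|exact: hy].
Qed.

Lemma hull_convex : amb_convex (hull amb_convex).
Proof.
split=> [x y hx hy I II RI|x y hx hy I II RI|x y z hx hz xy yz I II RI];
  have [Ij Im Ic] := II.
- by apply: Ij; [exact: hx|exact: hy].
- by apply: Im; [exact: hx|exact: hy].
- by apply: Ic xy yz; [exact: hx|exact: hz].
Qed.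

Lemma ideal_convex I : amb_ideal I -> amb_convex I.
Proof.
move=> [Il Ij]; split=> // [x y Ix Iy|x y z _ Iz _ yz]; last exact: Il yz Iz.
by apply: Il Ix; case: (vl_meet_lb x y).
Qed.

Lemma filter_convex I : amb_filter I -> amb_convex I.
Proof.
move=> [Il Ij]; split=> // [x y Ix Iy|x y z Ix _ xy _]; last exact: Il xy Ix.
by apply: Il Ix; case: (vl_join_ub x y).
Qed.

Definition phi_range : set S :=
  smallest (@subsemilattice0 dS S) [set s | exists k c, s = @phi k c].

(** The values bounded by the length of an interval in [C] form a subsemilattice containing all
    ranges. By cofinality each [s] is such a value, and [rich_between] then realizes it exactly. *)
Lemma cofinal_onto C : (forall k (x : P k), C (emb x)) -> amb_convex C ->
  cofinal phi_range -> forall s, exists x y, [/\ C x, C y & vl_d x y = s].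
Proof.
move=> C_emb [Cj Cm Cc] cof s.
pose E : set S := [set e | exists a c,
  [/\ C a, C c, vl_d a c = \bot & e <= vl_d c a]].
have E_semi : subsemilattice0 E.
  split; first by exists (emb (f k0 z0)), (emb (f k0 z0)); rewrite vl_refl.
  move=> e e' [a [c [Ca Cc' ac ec]]] [a' [c' [Ca' Cc'' ac' ec']]].
  exists (vl_meet a a'), (vl_join c c'); split; [exact: Cm|exact: Cj| |].
    have [h _] := vl_meet_lb a a'; have [h' _] := vl_join_ub c c'.
    apply/eqP; rewrite -lex0 (le_trans (vl_trans a _ _)) // h join0x.
    by rewrite (le_trans (vl_trans c _ _)) // ac h' joinx0.
  rewrite vl_joinE !vl_meetE leUx; apply/andP; split.
    by apply: le_trans ec _; join_le.
  by apply: le_trans ec' _; join_le.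
have E_phi k c : E (@phi k c).
  elim/conc_ind: c => [|a b Ea Eb|x y]; first by rewrite (phi_hom k).2; case: E_semi.
    by rewrite (phi_hom k).1; apply: E_semi.2.
  have [h h'] := vl_join_ub (emb x) (emb y).
  (* The interval from [emb y] up to this join has length [vl_d (emb x) (emb y)]. *)
  exists (emb y), (vl_join (emb x) (emb y)); split=> //; first exact: Cj.
  by rewrite vl_joinE vl_refl joinx0 emb_d.
have [e Ee se] := cof s.
have [a [c [Ca Cc' ac ec]]] : E e.
  by apply: Ee; split=> // _ [k [c ->]].
have [t [at_ tc cts]] := rich_between S_ccB ambient_rich ac (le_trans se ec).
by exists c, t; split=> //; apply: Cc Ca Cc' at_ tc.
Qed.

Lemma ideal_onto C : (forall k (x : P k), C (emb x)) -> amb_ideal C ->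
  forall s, exists x y, [/\ C x, C y & vl_d x y = s].
Proof.
move=> C_emb [Cl _] s.
have [t [to ots]] := rich_below ambient_rich (emb (f k0 z0)) s.
by exists (emb (f k0 z0)), t; split=> //; apply: Cl to _.
Qed.

Lemma filter_onto C : (forall k (x : P k), C (emb x)) -> amb_filter C ->
  forall s, exists x y, [/\ C x, C y & vl_d x y = s].
Proof.
move=> C_emb [Cl _] s.
have [t [ot tos]] := rich_above ambient_rich (emb (f k0 z0)) s.
by exists t, (emb (f k0 z0)); split=> //; apply: Cl ot _.
Qed.

(** [Gen] is to be [lattice_ideal] or [lattice_filter]; generation says that a set of this kind
    containing all images is everything. *)
Definition family_solution
    (Gen : forall d (L : latticeType d), set L -> Prop) : Prop :=
  exists (d : Order.disp_t) (L : latticeType d) (Lne : inhabited L)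
    (g : forall k, platHom (P k) (plat_of_lattice Lne))
    (psi : conc (plat_of_lattice Lne) -> S),
  [/\ relatively_complemented L, semilattice0_hom psi /\ bijective psi,
      forall k l z, g k (f k z) = g l (f l z),
      forall k, @phi k =1 psi \o conc_map (g k)
    & forall D : set L, (forall k x, D (g k x)) ->
        (Gen _ _ D -> forall a, D a) /\
        (cofinal phi_range -> convex_sublattice D -> forall a, D a)].

Lemma convex_solution C (C_emb : forall k (x : P k), C (emb x))
    (C_convex : amb_convex C)
    (Gen : forall d (L : latticeType d), set L -> Prop) :
  (forall s, exists x y, [/\ C x, C y & vl_d x y = s]) ->
  (forall (Cj : forall x y, C x -> C y -> C (vl_join x y))
      (Cm : forall x y, C x -> C y -> C (vl_meet x y))
      (D : set (cvx_lat C_emb Cj Cm)),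
    (forall k (x : P k), D (cvx_pi C_emb Cj Cm (C_emb k x))) ->
    (Gen _ _ D -> forall a, D a) /\
    (cofinal phi_range -> convex_sublattice D -> forall a, D a)) ->
  family_solution Gen.
Proof.
move=> onto gen; have [Cj Cm Cc] := C_convex.
exists vquot_display, (cvx_lat C_emb Cj Cm), (cvx_inh C_emb Cj Cm),
  (cvx_g C_emb Cj Cm), (@cvx_psi C C_emb Cj Cm); split.
- exact: cvx_compl.
- split; [exact: cvx_psi_hom|exact: cvx_psi_bij].
- exact: cvx_g_f.
- exact: cvx_psi_g.
- exact: gen.
Qed.

Section Generation.
Variables (C : set ambient) (C_emb : forall k (x : P k), C (emb x)).
Variable Cj : forall x y, C x -> C y -> C (vl_join x y).
Variable Cm : forall x y, C x -> C y -> C (vl_meet x y).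
Notation pi := (cvx_pi C_emb Cj Cm).
Variable D : set (cvx_lat C_emb Cj Cm).
Hypothesis D_emb : forall k (x : P k), D (pi (@C_emb k x)).

Lemma emb_pullback : emb_range `<=` pullback D.
Proof. by move=> _ [k [x ->]]; exists (@C_emb k x). Qed.

Lemma pullback_ideal : amb_ideal C -> lattice_ideal D -> amb_ideal (pullback D).
Proof.
move=> [Cl _] [_ Dl Dj]; split=> [x y xy [Cy Dy]|x y [Cx Dx] [Cy Dy]].
  exists (Cl _ _ xy Cy); apply: Dl Dy.
  by rewrite cvx_pi_le xy.
by exists (Cj Cx Cy); rewrite -cvx_pi_join; apply: Dj.
Qed.

Lemma pullback_filter : amb_filter C -> lattice_filter D -> amb_filter (pullback D).
Proof.
move=> [Cl _] [_ Dl Dj]; split=> [x y xy [Cy Dy]|x y [Cx Dx] [Cy Dy]].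
  exists (Cl _ _ xy Cy); apply: Dl Dy.
  by rewrite cvx_pi_le xy.
by exists (Cm Cx Cy); rewrite -cvx_pi_meet; apply: Dj.
Qed.

Lemma pullback_convex : amb_convex C -> convex_sublattice D ->
  amb_convex (pullback D).
Proof.
move=> [_ _ Cc] [Ds Dc].
split=> [x y [Cx Dx] [Cy Dy]|x y [Cx Dx] [Cy Dy]|x y z [Cx Dx] [Cz Dz] xy yz].
- by exists (Cj Cx Cy); rewrite -cvx_pi_join; case: (Ds _ _ Dx Dy).
- by exists (Cm Cx Cy); rewrite -cvx_pi_meet; case: (Ds _ _ Dx Dy).
- exists (Cc _ _ _ Cx Cz xy yz); apply: Dc Dx Dz _ _.
    by rewrite cvx_pi_le xy.
  by rewrite cvx_pi_le yz.
Qed.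

End Generation.

Lemma lattice_ideal_convex d (L : latticeType d) (D : set L) :
  lattice_ideal D -> convex_sublattice D.
Proof.
move=> [_ Dl Dj]; split=> [x y Dx Dy|x y z _ Dz _ yz]; last exact: Dl yz Dz.
by split; [apply: Dl Dx; exact: leIl|exact: Dj].
Qed.

Lemma lattice_filter_convex d (L : latticeType d) (D : set L) :
  lattice_filter D -> convex_sublattice D.
Proof.
move=> [_ Dl Dj]; split=> [x y Dx Dy|x y z Dx _ xy _]; last exact: Dl xy Dx.
by split; [exact: Dj|apply: Dl Dx; exact: leUl].
Qed.

(** The convex hull of the images attains every value here, and as ideals and filters are convex,
    generation as a convex sublattice gives both conclusions. *)
Lemma cofinal_solution (Gen : forall d (L : latticeType d), set L -> Prop) :
  (forall d (L : latticeType d) (D : set L), Gen _ _ D -> convex_sublattice D) ->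
  cofinal phi_range -> family_solution Gen.
Proof.
move=> GenC cof; have Cc := hull_convex.
apply: (convex_solution (C_emb := @hull_emb amb_convex) Cc).
  exact: (cofinal_onto (@hull_emb amb_convex) Cc cof).
move=> Cj Cm D D_emb.
suff h : convex_sublattice D -> forall a, D a by split=> // /GenC.
move=> Dc; apply: pullbackT => x; apply; first exact: pullback_convex.
exact: emb_pullback.
Qed.

(** If the ranges are cofinal, the convex hull works. Otherwise the ideal hull is taken, which
    attains every value below a point, and the claim on convex sublattices is vacuous. *)
Lemma family_ideal : family_solution lattice_ideal.
Proof.
have [cof|ncof] := pselect (cofinal phi_range).
  by apply: cofinal_solution cof => d L D; exact: lattice_ideal_convex.
have Ci := hull_ideal.
apply: (convex_solution (C_emb := @hull_emb amb_ideal) (ideal_convex Ci)).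
  exact: (ideal_onto (@hull_emb amb_ideal) Ci).
move=> Cj Cm D D_emb; split=> // Di.
apply: pullbackT => x; apply; first exact: pullback_ideal.
exact: emb_pullback.
Qed.

Lemma family_filter : family_solution lattice_filter.
Proof.
have [cof|ncof] := pselect (cofinal phi_range).
  by apply: cofinal_solution cof => d L D; exact: lattice_filter_convex.
have Ci := hull_filter.
apply: (convex_solution (C_emb := @hull_emb amb_filter) (filter_convex Ci)).
  exact: (filter_onto (@hull_emb amb_filter) Ci).
move=> Cj Cm D D_emb; split=> // Di.
apply: pullbackT => x; apply; first exact: pullback_filter.
exact: emb_pullback.
Qed.

End FamilyAmalgamation.

(** * Two partial lattices as a family indexed by booleans *)

Section TwoLattices.
Variables (d0 : Order.disp_t) (P0 : latticeType d0) (P0ne : inhabited P0).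
Variables (P1 P2 : partialLattice).
Variables (f1 : platHom (plat_of_lattice P0ne) P1)
  (f2 : platHom (plat_of_lattice P0ne) P2).
Variables (dS : Order.disp_t) (S : bLatticeType dS).
Hypothesis S_ccB : conditionally_co_Brouwerian S.
Variables (phi1 : conc P1 -> S) (phi2 : conc P2 -> S).
Hypothesis phi1_hom : semilattice0_hom phi1.
Hypothesis phi2_hom : semilattice0_hom phi2.
Hypothesis phi_f : phi1 \o conc_map f1 =1 phi2 \o conc_map f2.

Definition pair_plat (b : bool) : partialLattice := if b then P1 else P2.

Definition pair_f (b : bool) : platHom (plat_of_lattice P0ne) (pair_plat b) :=
  match b with true => f1 | false => f2 end.

Definition pair_phi (b : bool) : conc (pair_plat b) -> S :=
  match b with true => phi1 | false => phi2 end.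

Lemma pair_phi_hom b : semilattice0_hom (@pair_phi b).
Proof. by case: b. Qed.

Lemma pair_phi_f (b b' : bool) c :
  pair_phi (conc_map (pair_f b) c) = pair_phi (conc_map (pair_f b') c).
Proof. by case: b b' => [] [] //; [exact: phi_f|exact/esym/phi_f]. Qed.

Lemma pair_phi_range :
  phi_range pair_phi = smallest (@subsemilattice0 dS S) (range phi1 `|` range phi2).
Proof.
congr smallest; apply/seteqP; split=> s.
  by move=> [[] [c ->]]; [left|right]; exists c.
by move=> [[c _ <-]|[c _ <-]]; [exists true, c|exists false, c].
Qed.

Lemma pair_solution (Gen : forall d (L : latticeType d), set L -> Prop) :
  family_solution pair_f pair_phi Gen ->
  exists (d : Order.disp_t) (L : latticeType d) (Lne : inhabited L)
     (g1 : platHom P1 (plat_of_lattice Lne))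
     (g2 : platHom P2 (plat_of_lattice Lne))
     (psi : conc (plat_of_lattice Lne) -> S),
     relatively_complemented L /\
     (semilattice0_hom psi /\ bijective psi) /\
     g1 \o f1 =1 g2 \o f2 /\
     phi1 =1 psi \o conc_map g1 /\
     phi2 =1 psi \o conc_map g2 /\
     smallest (Gen d L) (range g1 `|` range g2) = setT /\
     (cofinal (smallest (@subsemilattice0 dS S) (range phi1 `|` range phi2)) ->
      smallest (@convex_sublattice d L) (range g1 `|` range g2) = setT).
Proof.
move=> [d [L [Lne [g [psi [Lc Lpsi gf phig gen]]]]]].
have {}gen (D : set L) : range (g true) `|` range (g false) `<=` D ->
    (Gen d L D -> forall a, D a) /\
    (cofinal (phi_range pair_phi) -> convex_sublattice D -> forall a, D a).
  by move=> gD; apply: gen => -[] x; apply: gD; [left|right]; exists x.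
exists d, L, Lne, (g true), (g false), psi.
split=> //; split=> //; split; first exact: (gf true false).
split; first exact: (phig true).
split; first exact: (phig false).
split.
  apply/seteqP; split=> // a _ D [GD /gen[gD _]]; exact: gD.
rewrite -pair_phi_range => cof.
by apply/seteqP; split=> // a _ D [cD /gen[_ gD]]; exact: gD.
Qed.

End TwoLattices.

Theorem theorem5
  (d0 : Order.disp_t) (P0 : latticeType d0) (P0ne : inhabited P0)
  (P1 P2 : partialLattice)
  (f1 : platHom (plat_of_lattice P0ne) P1)
  (f2 : platHom (plat_of_lattice P0ne) P2)
  (dS : Order.disp_t) (S : bLatticeType dS)
  (S_ccB : conditionally_co_Brouwerian S)
  (phi1 : conc P1 -> S) (phi2 : conc P2 -> S)
  (phi1_hom : semilattice0_hom phi1) (phi2_hom : semilattice0_hom phi2)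
  (phi_f : phi1 \o conc_map f1 =1 phi2 \o conc_map f2) :
  (exists (d : Order.disp_t) (L : latticeType d) (Lne : inhabited L)
     (g1 : platHom P1 (plat_of_lattice Lne))
     (g2 : platHom P2 (plat_of_lattice Lne))
     (psi : conc (plat_of_lattice Lne) -> S),
     relatively_complemented L /\
     (semilattice0_hom psi /\ bijective psi) /\
     g1 \o f1 =1 g2 \o f2 /\
     phi1 =1 psi \o conc_map g1 /\
     phi2 =1 psi \o conc_map g2 /\
     smallest (@lattice_ideal d L) (range g1 `|` range g2) = setT /\
     (cofinal (smallest (@subsemilattice0 dS S) (range phi1 `|` range phi2)) ->
      smallest (@convex_sublattice d L) (range g1 `|` range g2) = setT))
  /\
  (exists (d : Order.disp_t) (L : latticeType d) (Lne : inhabited L)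
     (g1 : platHom P1 (plat_of_lattice Lne))
     (g2 : platHom P2 (plat_of_lattice Lne))
     (psi : conc (plat_of_lattice Lne) -> S),
     relatively_complemented L /\
     (semilattice0_hom psi /\ bijective psi) /\
     g1 \o f1 =1 g2 \o f2 /\
     phi1 =1 psi \o conc_map g1 /\
     phi2 =1 psi \o conc_map g2 /\
     smallest (@lattice_filter d L) (range g1 `|` range g2) = setT /\
     (cofinal (smallest (@subsemilattice0 dS S) (range phi1 `|` range phi2)) ->
      smallest (@convex_sublattice d L) (range g1 `|` range g2) = setT)).

Proof.
have [z0] := P0ne; split; apply: pair_solution.
  exact: (family_ideal true S_ccB (pair_phi_hom phi1_hom phi2_hom)
    (pair_phi_f phi_f) z0).
exact: (family_filter true S_ccB (pair_phi_hom phi1_hom phi2_hom)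
  (pair_phi_f phi_f) z0).
Qed.
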